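(* Let $n\geq 14$ be even, let $6\leq r\leq (n-2)/2$, and put $i=n/2-r$ (so $i\geq 1$). Let $V=\{t_1,\dots,t_{i+r+2}\}\sqcup\{s_1,\dots,s_{i+r-2}\}$ (so $|V|=n$) and consider the labelled graph on $V$ with edges: a terminal-1 alternating path on $t_1,\dots,t_{i+4}$; edges $\{t_{i+k+2},t_{i+k+3}\}$ with label $k$ for $2\leq k\leq r-1$; a terminal-1 alternating path on $s_1,\dots,s_i$; edges $\{s_{i+k-2},s_{i+k-1}\}$ with label $k$ for $2\leq k\leq r-1$; and the two edges $\{t_{i+r+1},s_{i+r-3}\}$ and $\{t_{i+r+2},s_{i+r-2}\}$ with label $r-3$. Then $G\cong A_n$ and $(G,(\rho_0,\dots,\rho_{r-1}))$ is a string C-group of rank $r$ with Schläfli type $\{\mathrm{lcm}(i+4,i),6,3^{r-6},6,6,3\}$.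
   Context: A string group generated by involutions (sggi) of rank $r$ is a pair $(G,(\rho_0,\dots,\rho_{r-1}))$ where $\rho_0,\dots,\rho_{r-1}$ are involutions generating the group $G$ such that $(\rho_i\rho_j)^2=1$ whenever $|i-j|\geq 2$. It is a string C-group if in addition it satisfies the intersection property: for all $J,K\subseteq\{0,\dots,r-1\}$, $\langle \rho_j : j\in J\rangle\cap\langle\rho_k : k\in K\rangle=\langle \rho_j : j\in J\cap K\rangle$. The Schläfli type is $\{p_1,\dots,p_{r-1}\}$ where $p_i$ is the order of $\rho_{i-1}\rho_i$; $3^k$ denotes $k$ consecutive entries equal to $3$ (omitted if $k=0$). Labelled-graph convention: the vertex set $V$ is finite, and each edge $\{a,b\}$ ($a\neq b$) carries one or more labels from $\{0,\dots,r-1\}$, the edges carrying any given label being pairwise disjoint; $\rho_k$ denotes the permutation of $V$ equal to the product of the transpositions $(a\,b)$ over all edges $\{a,b\}$ carrying label $k$, and $G=\langle\rho_0,\dots,\rho_{r-1}\rangle\leq \mathrm{Sym}(V)$. A terminal-1 alternating path on vertices $v_1,\dots,v_a$ means the edges $\{v_s,v_{s+1}\}$ ($1\leq s\leq a-1$), where $\{v_s,v_{s+1}\}$ carries label $1$ if $a-s$ is odd and label $0$ if $a-s$ is even (so the last edge carries label 1 and labels alternate; if $a=1$ there are no edges). *)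

(* Defs.v *)
From HB Require Import structures.
From mathcomp Require Import all_boot all_order all_fingroup all_solvable.
Set Implicit Arguments. Unset Strict Implicit. Unset Printing Implicit Defensive.

Local Open Scope group_scope.

Definition gens (T : finType) (r : nat) (rho : nat -> {perm T}) (J : {set 'I_r})
  : {set {perm T}} := [set rho (nat_of_ord j) | j in J].

Definition sggi_group (T : finType) (r : nat) (rho : nat -> {perm T}) :=
  <<gens rho [set: 'I_r]>>.

Definition is_sggi (T : finType) (r : nat) (rho : nat -> {perm T}) : Prop :=
  (forall k, (k < r)%N -> #[rho k] = 2%N) /\
  (forall j k, (j < r)%N -> (k < r)%N -> (j + 2 <= k \/ k + 2 <= j)%N ->
      (rho j * rho k) ^+ 2 = 1).

Definition intersection_property (T : finType) (r : nat) (rho : nat -> {perm T})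
  : Prop :=
  forall J K : {set 'I_r},
    <<gens rho J>> :&: <<gens rho K>> = <<gens rho (J :&: K)>>.

Definition string_C_group (T : finType) (r : nat) (rho : nat -> {perm T}) : Prop :=
  is_sggi r rho /\ intersection_property r rho.

Definition schlafli (T : finType) (r : nat) (rho : nat -> {perm T}) : seq nat :=
  [seq #[rho j * rho j.+1] | j <- iota 0 (r.-1)].

(* An edge is (a, b, label) with a, b vertex numbers. *)

(* transposition (a b) on 'I_n, for a, b < n (identity otherwise) *)
Definition ntperm (n a b : nat) : {perm 'I_n} :=
  match @insub _ (fun x => x < n) 'I_n a, @insub _ (fun x => x < n) 'I_n b with
  | Some x, Some y => tperm x y
  | _, _ => 1
  end.

Definition graph_rho (n : nat) (E : seq (nat * nat * nat)) (k : nat)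
  : {perm 'I_n} :=
  \prod_(e <- E | e.2 == k) ntperm n e.1.1 e.1.2.

Definition alt_path (v : nat -> nat) (a : nat) : seq (nat * nat * nat) :=
  [seq (v s, v s.+1, if odd (a - s) then 1 else 0)%N | s <- iota 1 a.-1].

(* vertices: t_j (1 <= j <= i+r+2) is numbered j-1,
             s_j (1 <= j <= i+r-2) is numbered (i+r+2) + (j-1). *)
Definition tv (j : nat) : nat := j.-1.
Definition sv (i r j : nat) : nat := (i + r + 2 + j.-1)%N.

Definition thm41_edges (i r : nat) : seq (nat * nat * nat) :=
  (alt_path tv (i + 4)
  ++ [seq (tv (i + k + 2), tv (i + k + 3), k) | k <- iota 2 (r - 2)]
  ++ alt_path (sv i r) i
  ++ [seq (sv i r (i + k - 2), sv i r (i + k - 1), k) | k <- iota 2 (r - 2)]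
  ++ [:: (tv (i + r + 1), sv i r (i + r - 3), r - 3);
         (tv (i + r + 2), sv i r (i + r - 2), r - 3)])%N.

Definition thm41_rho (n r : nat) : nat -> {perm 'I_n} :=
  graph_rho n (thm41_edges (n./2 - r) r).

(* Main.v *)
(**
By the string structure, the intersection property reduces to intervals of labels:
an element g common to <rho_(a-1), ..., rho_(b-1)> and <rho_a, ..., rho_b> must lie in
<rho_a, ..., rho_(b-1)>. Pair the points {t_(i+2+j), s_(i-2+j)} into blocks, 1 <= j <= r.
For k >= 1 the generator rho_k permutes the blocks as the transposition (k, k+1), and
rho_(r-3) moreover exchanges the two points of each of the last two blocks. Since g
stabilises block b+1, it acts on the blocks like an element of the smaller group, and
it remains to treat elements that only flip blocks. These flip an even number of
blocks, all generators being even; (rho_(r-4) rho_(r-3))^3 flips exactly the last two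
blocks, and its conjugates give all the even flips that are needed.

If i = 1 then block 1 is incomplete and rho_1 breaks the blocks. Instead, for a = 1,
the group <rho_1, ..., rho_(b-1)> contains (x y)(p q), where p = t_3 and q = t_2, for
all points x and y of blocks 1, ..., b in the same orbit; hence it contains every even
permutation of these points and p, q that preserves these orbits and {p, q}.

Finally rho_0 rho_1 is the product of a cycle of length i+4 on the t-points and of one
of length i on the s-points, so the commutator of (rho_0 rho_1)^i with rho_2 is a
3-cycle, and its conjugates generate the alternating group.
*)

Require Import Defs.
From mathcomp Require Import all_boot all_order all_fingroup all_solvable.
From mathcomp Require Import zify.

Set Implicit Arguments.
Unset Strict Implicit.
Unset Printing Implicit Defensive.

Local Open Scope group_scope.

(** In a finite group every element of [<<A>>] is a product of elements of [A], so right
    multiplication by generators suffices for an induction. *)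
Lemma gen_rect (gT : finGroupType) (A : {set gT}) (P : gT -> Prop) :
  P 1 -> (forall x y, P x -> y \in A -> P (x * y)) ->
  forall g, g \in <<A>> -> P g.
Proof.
move=> P1 PM g /gen_prodgP[m [c cA ->]].
elim: m c cA => [|m IH] c cA; first by rewrite big_ord0.
by rewrite big_ord_recr /=; apply: PM (cA _); apply: IH => j; apply: cA.
Qed.

(** * Intersection property from intervals of labels *)

Section StringCriterion.

Variables (T : finType) (r : nat) (rho : nat -> {perm T}).
Implicit Types (J K : {set 'I_r}).

Definition interval a b : {set 'I_r} := [set j : 'I_r | a <= j < b].

Definition gens_group (J : {set 'I_r}) : {group {perm T}} :=
  [group of <<gens rho J>>].
Local Notation Gam := gens_group.

Lemma mem_gens (J : {set 'I_r}) (j : 'I_r) : j \in J -> rho j \in Gam J.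
Proof. by move=> jJ; apply/mem_gen/imset_f. Qed.

Lemma gens_groupS (J K : {set 'I_r}) : J \subset K -> Gam J \subset Gam K.
Proof. by move=> sJK; apply/genS/imsetS. Qed.

Lemma gens_groupP (J K : {set 'I_r}) g :
  J \subset K -> g \in Gam J -> g \in Gam K.
Proof. by move=> /gens_groupS/subsetP; apply. Qed.

Lemma gens_group_rect (J : {set 'I_r}) (P : {perm T} -> Prop) :
  P 1 -> (forall g (j : 'I_r), P g -> j \in J -> P (g * rho j)) ->
  forall g, g \in Gam J -> P g.
Proof.
move=> P1 PM; apply: gen_rect => // g _ Pg /imsetP[j jJ ->].
exact: PM.
Qed.

Hypothesis rho_comm : forall j k, j < r -> k < r -> j + 2 <= k ->
  commute (rho j) (rho k).

Definition precedes (J K : {set 'I_r}) :=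
  forall j k : 'I_r, j \in J -> k \in K -> j + 2 <= k.

Lemma precedesS (J J' K K' : {set 'I_r}) :
  J' \subset J -> K' \subset K -> precedes J K -> precedes J' K'.
Proof. by move=> /subsetP sJ /subsetP sK p j k /sJ jJ /sK; apply: p. Qed.

Lemma precedes_interval a m b : precedes (interval a m) (interval m.+1 b).
Proof. by move=> j k; rewrite !inE; lia. Qed.

Lemma intervalS a b c d : c <= a -> b <= d -> interval a b \subset interval c d.
Proof. by move=> ca bd; apply/subsetP=> x; rewrite !inE; lia. Qed.

Lemma intervalI a b c d e f : e <= maxn a c -> minn b d <= f ->
  interval a b :&: interval c d \subset interval e f.
Proof. by move=> ea bf; apply/subsetP=> x; rewrite !inE; lia. Qed.

Lemma interval_gap0 a m b : interval a m :&: interval m.+1 b = set0.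
Proof. by apply/setP=> x; rewrite !inE; lia. Qed.

Lemma sub_gap_lo (J : {set 'I_r}) a b m :
  J \subset interval a b -> J :&: interval 0 m \subset interval a m.
Proof.
move=> sJ; apply: subset_trans (setSI _ sJ) _.
by apply: intervalI; rewrite ?maxn0 ?geq_minr.
Qed.

Lemma sub_gap_hi (J : {set 'I_r}) a b m :
  J \subset interval a b -> J :&: interval m.+1 r \subset interval m.+1 b.
Proof.
move=> sJ; apply: subset_trans (setSI _ sJ) _.
by apply: intervalI; rewrite ?leq_maxr ?geq_minl.
Qed.

Lemma split_gap (J : {set 'I_r}) (j : 'I_r) : j \notin J ->
  J = (J :&: interval 0 j) :|: (J :&: interval j.+1 r).
Proof.
move=> jJ; apply/setP=> x; rewrite !inE -andb_orr.
case: (boolP (x \in J)) => //= xJ; rewrite ltn_ord andbT.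
by case: ltngtP => // /val_inj xj; rewrite -xj xJ in jJ.
Qed.

(** Labels at distance at least 2 commute, so the two groups centralise each other and their join is
    their product. *)
Lemma gens_groupU (J K : {set 'I_r}) :
  precedes J K -> Gam (J :|: K) = Gam J * Gam K :> {set _}.
Proof.
move=> JK; have cJK : Gam K \subset 'C(Gam J).
  rewrite gen_subG; apply/subsetP=> _ /imsetP[k kK ->].
  rewrite /= cent_gen; apply/centP=> _ /imsetP[j jJ ->].
  by apply/commute_sym/rho_comm; rewrite ?ltn_ord ?JK.
by rewrite -(cent_joinEr cJK) joing_idl joing_idr /= /gens imsetU.
Qed.

(** Only the inclusion that can fail is recorded; the other one is monotonicity. *)
Definition IPon (a b : nat) := forall J K : {set 'I_r},
  J \subset interval a b -> K \subset interval a b ->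
  Gam J :&: Gam K \subset Gam (J :&: K).

Lemma IPonP a b (J K L : {set 'I_r}) g : IPon a b ->
  J \subset interval a b -> K \subset interval a b -> J :&: K \subset L ->
  g \in Gam J -> g \in Gam K -> g \in Gam L.
Proof.
move=> ip sJ sK sL gJ gK; apply: (gens_groupP sL).
by apply: (subsetP (ip J K sJ sK)); rewrite inE gJ.
Qed.

(* McMullen-Schulte, Prop. 2E16. With [J] missing [j] and [K] missing [k >= j],
   write an element of both groups as [x1 * x2 = y1 * y2] along these gaps: the
   element [y1^-1 * x1 = y2 * x2^-1] then belongs to both end parabolics, hence
   to the group of the labels strictly between [j] and [k]. *)
Lemma IPon_step_gap a b (j k : 'I_r) (J K : {set 'I_r}) :
  IPon a b -> IPon a.+1 b.+1 ->
  Gam (interval a b) :&: Gam (interval a.+1 b.+1) \subset Gam (interval a.+1 b) ->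
  a <= j <= k -> k <= b ->
  J \subset interval a b.+1 -> K \subset interval a b.+1 ->
  j \notin J -> k \notin K ->
  Gam J :&: Gam K \subset Gam (J :&: K).
Proof.
move=> ipl ipr sI /andP[aj jk] kb sJ sK jJ kK.
pose M := interval j.+1 k.
pose JL := J :&: interval 0 j; pose JR := J :&: interval j.+1 r.
pose KL := K :&: interval 0 k; pose KR := K :&: interval k.+1 r.
have sJL : JL \subset interval a j by apply: sub_gap_lo sJ.
have sKL : KL \subset interval a k by apply: sub_gap_lo sK.
have sJR : JR \subset interval j.+1 b.+1 by apply: sub_gap_hi sJ.
have sKR : KR \subset interval k.+1 b.+1 by apply: sub_gap_hi sK.
have sMl : M \subset interval a b by apply: intervalS => //; apply: leqW.
have sMr : M \subset interval a.+1 b.+1 by apply: intervalS => //; apply: leqW.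
have sJLl : JL \subset interval a b.
  by apply: subset_trans sJL (intervalS _ (leq_trans jk kb)).
have sKLl : KL \subset interval a b by apply: subset_trans sKL (intervalS _ kb).
have sJRr : JR \subset interval a.+1 b.+1 by apply: subset_trans sJR (intervalS _ _).
have sKRr : KR \subset interval a.+1 b.+1.
  by apply: subset_trans sKR (intervalS _ _) => //; apply: leq_trans jk.
apply/subsetP=> g /setIP[].
rewrite {1}(split_gap jJ) {1}(split_gap kK) !gens_groupU; last first.
- by apply: (precedesS (subsetIr _ _) (subsetIr _ _)); apply: precedes_interval.
- by apply: (precedesS (subsetIr _ _) (subsetIr _ _)); apply: precedes_interval.
case/mulsgP=> x1 x2 x1J x2J -> /mulsgP[y1 y2 y1K y2K e12].
pose u := y1^-1 * x1.
have uE : u = y2 * x2^-1 by rewrite /u -[x1](mulgK x2) e12 !mulgA mulVg mul1g.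
have ul : u \in Gam (interval a k).
  apply: groupM; first by apply/groupVr/(gens_groupP _ y1K).
  by apply: gens_groupP x1J; apply: subset_trans sJL (intervalS _ _).
have ur : u \in Gam (interval j.+1 b.+1).
  rewrite uE; apply: groupM; last by apply/groupVr/(gens_groupP _ x2J).
  by apply: gens_groupP y2K; apply: subset_trans sKR (intervalS _ _).
have um : u \in Gam (interval a.+1 b).
  apply: (subsetP sI); rewrite inE (gens_groupP _ ul) ?(gens_groupP _ ur) //.
    exact: intervalS.
  exact: intervalS.
have uM : u \in Gam M.
  have ulm : u \in Gam (interval a.+1 k).
    apply: (IPonP ipl _ _ _ ul um); try by apply: intervalS.
    by apply: intervalI; rewrite ?leq_maxr ?geq_minl.
  have urm : u \in Gam (interval j.+1 b).
    apply: (IPonP ipr _ _ _ ur um); try by apply: intervalS.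
    by apply: intervalI; rewrite ?leq_maxl ?geq_minr.
  apply: (IPonP ipl _ _ _ ulm urm); try by apply: intervalS => //; apply: leqW.
  by apply: intervalI; rewrite ?leq_maxr ?geq_minl.
have y1E : y1 = x1 * u^-1 by rewrite /u invMg invgK mulKVg.
have y2E : y2 = u * x2 by rewrite uE mulgKV.
(* [y1 = x1 * u^-1] lies in the groups of [JL :|: M] and of [KL], both inside the left interval,
   where the property is known; [x2] is treated symmetrically on the right. *)
have y1d : y1 \in Gam ((JL :&: K) :|: (M :&: K)).
  apply: (IPonP (J := JL :|: M) (K := KL) ipl) => //.
  - by rewrite subUset sJLl.
  - by rewrite -setIUl setIS // subsetIl.
  rewrite y1E; apply: groupM; last apply: groupVr.
    by apply: gens_groupP x1J; apply: subsetUl.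
  by apply: gens_groupP uM; apply: subsetUr.
have x2d : x2 \in Gam ((M :&: J) :|: (KR :&: J)).
  apply: (IPonP (J := M :|: KR) (K := JR) ipr) => //.
  - by rewrite subUset sMr.
  - by rewrite -setIUl setIS // subsetIl.
  rewrite -[x2](mulKg u) -y2E; apply: groupM; first apply: groupVr.
    by apply: gens_groupP uM; apply: subsetUl.
  by apply: gens_groupP y2K; apply: subsetUr.
move: y1d; rewrite gens_groupU; last first.
  apply: (precedesS _ _ (@precedes_interval a j k)); last exact: subsetIl.
  exact: subset_trans (subsetIl _ _) sJL.
case/mulsgP=> v1 v2 v1d v2d y1v.
move: x2d; rewrite gens_groupU; last first.
  apply: (precedesS _ _ (@precedes_interval j.+1 k b.+1)); first exact: subsetIl.
  exact: subset_trans (subsetIl _ _) sKR.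
case/mulsgP=> w1 w2 w1d w2d x2w.
have Gam0 : Gam set0 = 1 :> {set _} by rewrite /= /gens imset0 gen0.
(* [v2 * u] lies in the groups of the disjoint sets [JL] and [M], hence is 1, and likewise [u * w1].
   So [v2 = w1] is a middle factor common to [J] and [K]. *)
have v2u : v2 * u = 1.
  apply/set1gP; rewrite -Gam0.
  apply: (IPonP (J := JL) (K := M) ipl) => //.
  - by rewrite -(interval_gap0 a j k); apply: setSI.
  - have -> : v2 * u = v1^-1 * x1 by rewrite /u y1v invMg !mulgA mulgV mul1g.
    apply: groupM => //; apply: groupVr.
    by apply: gens_groupP v1d; apply: subsetIl.
  by apply: groupM uM; apply: gens_groupP v2d; apply: subsetIl.
have uw1 : u * w1 = 1.
  apply/set1gP; rewrite -Gam0.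
  apply: (IPonP (J := M) (K := KR) ipr) => //.
  - by rewrite -(interval_gap0 j.+1 k b.+1); apply: setIS.
  - by apply: groupM => //; apply: gens_groupP w1d; apply: subsetIl.
  have -> : u * w1 = y2 * w2^-1 by rewrite y2E x2w !mulgA mulgK.
  apply: groupM => //; apply: groupVr.
  by apply: gens_groupP w2d; apply: subsetIl.
have v2w1 : v2 = w1.
  by rewrite -[v2](mulgK u) v2u mul1g -[w1](mulKg u) uw1 mulg1.
have -> : x1 * x2 = v1 * w1 * w2.
  by rewrite e12 y1v y2E x2w -[v1 * v2 * _]mulgA [v2 * (u * _)]mulgA v2u mul1g mulgA.
rewrite !groupM //.
- by apply: gens_groupP v1d; rewrite setSI // subsetIl.
- apply: (IPonP (J := M :&: K) (K := M :&: J) ipl) => //.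
  + exact: subset_trans (subsetIl _ _) sMl.
  + exact: subset_trans (subsetIl _ _) sMl.
  + by rewrite setIC setISS // subsetIr.
  by rewrite -v2w1.
by apply: gens_groupP w2d; rewrite setIC setIS // subsetIl.
Qed.

(** Induction on the length of the interval. A label set equal to the whole interval is a trivial
    case; otherwise each set misses a label, and by symmetry [J] may be taken to miss the smaller
    one. *)
Lemma IPon_string :
  (forall a b, a < b < r ->
    Gam (interval a b) :&: Gam (interval a.+1 b.+1) \subset Gam (interval a.+1 b)) ->
  forall a b, b <= r -> IPon a b.
Proof.
move=> sI a b; have [m] := ubnP (b - a); elim: m a b => // m IH a b.
rewrite ltnS => bam br J K sJ sK.
have [ba|ab] := leqP b a.
  have J0 : J = set0.
    apply/setP=> x; rewrite inE; apply/negP=> /(subsetP sJ); rewrite inE; lia.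
  by rewrite J0 set0I subIset ?subxx.
case: b ab => // b ab in bam br sJ sK *.
have [eJ|nJ] := eqVneq J (interval a b.+1).
  by rewrite eJ (setIidPr sK) subsetIr.
have [eK|nK] := eqVneq K (interval a b.+1).
  by rewrite eK (setIidPl sJ) subsetIl.
have gap (X : {set 'I_r}) : X \subset interval a b.+1 -> X != interval a b.+1 ->
    exists2 j : 'I_r, a <= j <= b & j \notin X.
  move=> sX nX; have : X \proper interval a b.+1 by rewrite properEneq nX.
  by case/properP=> _ [j]; rewrite inE => jI jX; exists j.
have [eab|nab] := eqVneq a b.
  have J0 (X : {set 'I_r}) : X \subset interval a b.+1 -> X != interval a b.+1 -> X = set0.
    move=> sX nX; have [j jab jX] := gap X sX nX.
    apply/setP=> x; rewrite inE; apply/negP=> xX.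
    have := subsetP sX x xX; rewrite inE => xab.
    by move: jX; rewrite (_ : j = x) ?xX //; apply: val_inj => /=; lia.
  by rewrite (J0 J sJ nJ) set0I subIset ?subxx.
have [j jab jJ] := gap J sJ nJ; have [k kab kK] := gap K sK nK.
have ipl : IPon a b by apply: IH; lia.
have ipr : IPon a.+1 b.+1 by apply: IH; lia.
have sab : Gam (interval a b) :&: Gam (interval a.+1 b.+1) \subset Gam (interval a.+1 b).
  by apply: sI; lia.
have [jk|kj] := leqP j k.
  by apply: (IPon_step_gap (j := j) (k := k) ipl ipr sab) => //; lia.
rewrite setIC [J :&: K]setIC.
by apply: (IPon_step_gap (j := k) (k := j) ipl ipr sab) => //; lia.
Qed.

Lemma intersection_property_string :
  (forall a b, a < b < r ->
    Gam (interval a b) :&: Gam (interval a.+1 b.+1) \subset Gam (interval a.+1 b)) ->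
  intersection_property r rho.
Proof.
move=> /IPon_string/(_ 0 r (leqnn r)) ip J K.
have sT (X : {set 'I_r}) : X \subset interval 0 r by apply/subsetP=> x _; rewrite inE /=.
apply/eqP; rewrite eqEsubset; apply/andP; split; first exact: ip.
by rewrite subsetI !gens_groupS ?subsetIl ?subsetIr.
Qed.

End StringCriterion.

(** * Groups of even permutations *)

Section EvenPermutations.

Variable V : finType.
Implicit Types (g c : {perm V}) (H : {group {perm V}}).

(** Such a permutation is 1 or the transposition of [p] and [q], and the latter is odd. *)
Lemma even_fix_but_two (p q : V) g : ~~ odd_perm g ->
  (forall x, x != p -> x != q -> g x = x) -> g = 1.
Proof.
move=> eg fg.
have imgpq x : (x == p) || (x == q) -> (g x == p) || (g x == q).
  move=> xpq; apply/norP=> -[np nq].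
  by have /perm_inj xE := fg _ np nq; rewrite -xE (negPf np) (negPf nq) in xpq.
have [gp|gp] := eqVneq (g p) p.
  apply/permP=> x; rewrite perm1.
  have [->//|xp] := eqVneq x p; have [xq|xq] := eqVneq x q; last exact: fg.
  have := imgpq q; rewrite eqxx orbT => /(_ isT) /orP[/eqP gq|/eqP gq]; last by rewrite xq.
  by have /perm_inj qp : g q = g p by [rewrite gp]; rewrite xq qp eqxx in xp.
have gpq : g p = q by have := imgpq p; rewrite eqxx (negPf gp) => /(_ isT) /eqP.
have pq : p != q by rewrite -gpq eq_sym.
have gqp : g q = p.
  have := imgpq q; rewrite eqxx orbT => /(_ isT) /orP[/eqP //|/eqP gq].
  by have /perm_inj qp : g q = g p by [rewrite gq]; rewrite qp eqxx in pq.
suff gE : g = tperm p q by rewrite gE odd_tperm pq in eg.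
apply/permP=> x; case: tpermP => [->//|->//|/eqP xp /eqP xq].
exact: fg.
Qed.

(** Descent on the number of moved points other than [p] and [q]: [c] sends [g x] back to [x] and
    disturbs no fixed point of [g] outside [{p, q}], so [g * c] moves fewer points. [Q] is an
    invariant of the descent. *)
Lemma even_reduce H (Q : {perm V} -> Prop) (p q : V) :
  H \subset 'Alt_V ->
  (forall g x, ~~ odd_perm g -> Q g -> x != p -> x != q -> g x != x ->
     exists c, [/\ c \in H, c (g x) = x, Q (g * c) &
       forall y, y != x -> y != g x -> y != p -> y != q -> c y = y]) ->
  forall g, ~~ odd_perm g -> Q g -> g \in H.
Proof.
move=> /subsetP HA red g.
have [m] := ubnP #|[set x | [&& x != p, x != q & g x != x]]|.
elim: m g => // m IH g; rewrite ltnS => cm eg Qg.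
have [e0|/set0Pn[x]] :=
    eqVneq [set x | [&& x != p, x != q & g x != x]] set0.
  suff -> : g = 1 by rewrite group1.
  apply: (@even_fix_but_two p q) => // x xp xq; apply/eqP/negPn/negP=> gx.
  by have := in_set0 x; rewrite -e0 inE xp xq gx.
rewrite inE => /and3P[xp xq gx].
have [c [cH cgx Qgc fc]] := red g x eg Qg xp xq gx.
rewrite -[g](mulgK c); apply: groupM; last exact: groupVr.
apply: IH => //; last first.
  by have := HA c cH; rewrite Alt_even odd_permM (negPf eg).
apply: leq_trans cm; apply: proper_card; apply/properP; split.
  apply/subsetP=> y; rewrite !inE => /and3P[yp yq]; rewrite yp yq permM /=.
  apply: contra => /eqP gy; rewrite gy; have [yx|yx] := eqVneq y x.
    by move: gx; rewrite -yx gy eqxx.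
  apply/eqP; apply: fc => //; apply: contra yx => /eqP ygx.
  by apply/eqP/(@perm_inj _ g); rewrite gy.
by exists x; rewrite !inE ?xp ?xq ?gx // permM cgx eqxx.
Qed.

(** The descent with exceptional points [a] and [b], each correction being a 3-cycle through both or
    a quotient of two such; the cases distinguish whether [g x] is itself [a] or [b]. *)
Lemma Alt_of_3cycles H (a b : V) : a != b -> H \subset 'Alt_V ->
  (forall y, y != a -> y != b -> tperm a b * tperm a y \in H) ->
  'Alt_V \subset H.
Proof.
move=> ab HA B; apply/subsetP=> g; rewrite Alt_even => eg.
apply: (@even_reduce H (fun=> True) a b) => // {eg}g x _ _ xa xb gx.
have Bx := B x xa xb; set y := g x in gx *.
have Bf u v : u != a -> u != b -> u != v -> (tperm a b * tperm a v) u = u.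
  by move=> ua ub uv; rewrite permM !tpermD // eq_sym.
have BVf u v : u != a -> u != b -> u != v -> (tperm a b * tperm a v)^-1 u = u.
  by move=> ua ub uv; apply: (canLR (permK _)); rewrite Bf.
have BVa v : v != a -> v != b -> (tperm a b * tperm a v)^-1 a = v.
  by move=> va vb; rewrite invMg !tpermV permM tpermL tpermD // eq_sym.
have [ya|ya] := eqVneq y a.
  exists (tperm a b * tperm a x)^-1; split=> //; first exact: groupVr.
    by rewrite ya BVa.
  by move=> z zx _ za zb; rewrite BVf.
have [yb|yb] := eqVneq y b.
  exists (tperm a b * tperm a x); split=> //.
    by rewrite yb permM tpermR tpermL.
  by move=> z zx _ za zb; rewrite Bf.
exists (tperm a b * tperm a y * (tperm a b * tperm a x)^-1); split=> //.
- by apply: groupM; [apply: B | apply: groupVr].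
- by rewrite permM permM (tpermD (z := y)) ?tpermR ?BVa // eq_sym.
by move=> z zx zy za zb; rewrite permM Bf // BVf.
Qed.

(* The factor [tperm p q] makes these elements even, so that they can lie in a group
   of even permutations. *)
Definition linked H (p q x y : V) := x = y \/ tperm x y * tperm p q \in H.

Section Linked.

Variables (H : {group {perm V}}) (p q : V).
Local Notation R := (linked H p q).

Lemma linked_sym x y : R x y -> R y x.
Proof. by case=> [->|]; [left | right; rewrite tpermC]. Qed.

(** Conjugating [(y z)(p q)] by [(x y)(p q)] gives [(x z)(p q)]. *)
Lemma linked_trans x y z : x != p -> x != q -> y != p -> y != q ->
  z != p -> z != q -> R x y -> R y z -> R x z.
Proof.
move=> xp xq yp yq zp zq; case=> [->//|xy]; case=> [<-|yz]; first by right.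
have [->|xz] := eqVneq x z; first by left.
have [eyz|nyz] := eqVneq y z; first by right; rewrite -eyz.
right; set w := tperm p q.
have wC u v : u != p -> u != q -> v != p -> v != q ->
    commute (tperm u v) w.
  move=> up uq vp vq; rewrite /commute /w conjgC tpermJ.
  by rewrite !tpermD // eq_sym.
have -> : tperm x z * w = (tperm x y * w) * (tperm y z * w) * (tperm x y * w)^-1.
  have -> : tperm x z = tperm x y * (tperm y z * tperm x y).
    by rewrite -{1}[tperm x y]tpermV -conjgE tpermJ tpermR tpermD.
  rewrite invMg !tpermV -!mulgA [w * (w * _)]mulgA tperm2 mul1g.
  by congr (_ * _); rewrite mulgA; apply/esym/commuteM; apply/commute_sym/wC.
by apply: groupM; [apply: groupM | apply: groupVr].
Qed.

Lemma linkedJ h x y : h \in H -> h p = p /\ h q = q \/ h p = q /\ h q = p ->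
  R x y -> R (h x) (h y).
Proof.
move=> hH hpq [->|xy]; first by left.
right; have -> : tperm p q = tperm p q ^ h.
  by rewrite tpermJ; case: hpq => -[-> ->] //; rewrite tpermC.
by rewrite -tpermJ -conjMg groupJ.
Qed.

(** The corrections of the descent are the elements [(x y)(p q)]; by transitivity they keep every
    point linked to its image. *)
Lemma mem_linked g : p != q -> H \subset 'Alt_V -> ~~ odd_perm g ->
  (forall x, x != p -> x != q -> [/\ g x != p, g x != q & R x (g x)]) ->
  g \in H.
Proof.
move=> pq HA; move: g.
pose Q g := forall x, x != p -> x != q -> [/\ g x != p, g x != q & R x (g x)].
apply: (@even_reduce H Q p q) => // g x eg Qg xp xq gx.
have [gp gq Rx] := Qg x xp xq; exists (tperm x (g x) * tperm p q).
have cE y : y != p -> y != q -> (tperm x (g x) * tperm p q) y = tperm x (g x) y.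
  move=> yp yq; rewrite permM; case: (@tpermP _ x (g x) y) => [_|_|yx ygx].
  - by rewrite tpermD // 1?eq_sym.
  - by rewrite tpermD // 1?eq_sym.
  by rewrite tpermD // 1?eq_sym.
split.
- by case: Rx => // /esym/eqP; rewrite (negPf gx).
- by rewrite cE // tpermR.
- move=> y yp yq; have [gyp gyq Ry] := Qg y yp yq; rewrite permM cE //.
  case: tpermP => [gyx|/perm_inj->|//]; last by split=> //; left.
  split=> //; apply: (linked_trans (y := x)) => //.
  by rewrite -gyx.
by move=> y yx ygx yp yq; rewrite cE // tpermD // eq_sym.
Qed.

End Linked.

End EvenPermutations.

(** * Disjoint permutations and swaps of consecutive numbers *)

Lemma commute_disjoint (T : finType) (p q : {perm T}) :
  (forall x, p x = x \/ q x = x) -> commute p q.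
Proof.
move=> pq; apply/permP=> x; rewrite !permM.
case: (pq x) => [px|qx]; rewrite ?px ?qx.
  by case: (pq (q x)) => [->//|/perm_inj qx]; rewrite qx.
by case: (pq (p x)) => [/perm_inj px|->//]; rewrite px.
Qed.

(* Innermost first: [lia] cannot use a condition that contains a conditional. *)
Ltac case_ifs :=
  repeat match goal with
  | |- context [if ?c then _ else _] =>
    lazymatch c with
    | context [if _ then _ else _] => fail
    | _ => let H := fresh in case H : c; try by [exfalso; lia]
    end
  end.

Definition swap_map (o v : nat) : nat :=
  if v == o then o.+1 else if v == o.+1 then o else v.

Lemma swap_mapK k : involutive (swap_map k).
Proof. by move=> d; rewrite /swap_map; case_ifs; lia. Qed.

Lemma swap_map_low k d : d < k -> swap_map k d = d.
Proof. by move=> dk; rewrite /swap_map; case_ifs; lia. Qed.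

Lemma swap_map_gt k d : k.+1 < d -> swap_map k d = d.
Proof. by move=> kd; rewrite /swap_map; case_ifs; lia. Qed.

Lemma swap_map_eq k d m : k.+1 < m ->
  (swap_map k d == k.+1) || (swap_map k d == m) = (d == k) || (d == m).
Proof. by move=> km; rewrite /swap_map; case_ifs; lia. Qed.

Lemma swap_map_high k d m : 2 < m ->
  (k == m - 3) && (m.-1 <= swap_map k d) = (k == m - 3) && (m.-1 <= d).
Proof.
move=> m2; have [->|] := eqVneq k (m - 3)%N => //=.
by rewrite /swap_map; case_ifs; lia.
Qed.

(** * The generators on vertex numbers *)

Section GraphPermutations.

Variable n : nat.

Lemma ntpermE a b (an : a < n) (bn : b < n) :
  ntperm n a b = tperm (Ordinal an) (Ordinal bn).
Proof. by rewrite /ntperm !insubT. Qed.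

Lemma val_ntperm a b (x : 'I_n) : a < n -> b < n ->
  ntperm n a b x = (if x == a :> nat then b else if x == b :> nat then a else x)
    :> nat.
Proof.
move=> an bn; rewrite (ntpermE an bn) permE /= -!val_eqE /=.
by case: ifP => // _; case: ifP.
Qed.

(** The hypotheses make [f] an involution whose moved pairs are the edges labelled [k]; these edges
    are then disjoint, and at most one transposition acts on a given point. *)
Lemma val_graph_rho (E : seq (nat * nat * nat)) k (f : nat -> nat) (x : 'I_n) :
  uniq E ->
  (forall e, e \in E -> e.2 = k ->
     [/\ e.1.1 < e.1.2 < n, f e.1.1 = e.1.2 & f e.1.2 = e.1.1]) ->
  (forall v, v < n -> f v != v -> ((v, f v, k) \in E) || ((f v, v, k) \in E)) ->
  graph_rho n E k x = f x :> nat.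
Proof.
move=> uE fE fmv; rewrite /graph_rho -big_filter.
pose endpt (y : nat) (e : nat * nat * nat) := (e.1.1 == y) || (e.1.2 == y).
suff {fmv} prodE : forall L : seq (nat * nat * nat), uniq L ->
    (forall e, e \in L -> (e \in E) && (e.2 == k)) -> forall y : 'I_n,
    (\prod_(e <- L) ntperm n e.1.1 e.1.2) y = (if has (endpt y) L then f y else y)
      :> nat.
  rewrite prodE ?filter_uniq // => [|e]; last by rewrite mem_filter andbC.
  case: hasP => [//|nh]; apply/eqP/negPn/negP; rewrite eq_sym => /(fmv _ (ltn_ord x)).
  move=> fx; apply: nh; case/orP: fx => xE.
    by exists (val x, f x, k); rewrite ?mem_filter ?xE ?eqxx // /endpt /= eqxx.
  by exists (f x, val x, k); rewrite ?mem_filter ?xE ?eqxx // /endpt /= eqxx orbT.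
elim=> [|[[a b] l] L IH] /=; first by move=> _ _ y; rewrite big_nil perm1.
move=> /andP[eL uL] LE y.
have /andP[eE /eqP lk] : ((a, b, l) \in E) && (l == k) by apply: LE; rewrite mem_head.
have [/= /andP[ab bn] fa fb] := fE _ eE lk.
have an := ltn_trans ab bn.
(* No other edge labelled [k] meets an endpoint of the head edge, since [f] would determine the same
   edge. *)
have nend z : z = a \/ z = b -> has (endpt z) L = false.
  move=> zab; apply/hasP=> -[[[a' b'] l'] e'L].
  have /andP[e'E /eqP/= l'k] : ((a', b', l') \in E) && (l' == k).
    by apply: LE; rewrite inE e'L orbT.
  have [/= /andP[ab' bn'] fa' fb'] := fE _ e'E l'k.
  have same : a' = a -> b' = b -> False.
    by move=> ea eb; move: eL; rewrite -ea -eb lk -l'k e'L.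
  case: zab => ->; rewrite /endpt /= => /orP[] /eqP ez.
  - by apply: same => //; rewrite -fa' ez.
  - by move: ab'; rewrite ez -fb' ez fa ltnNge ltnW.
  - by move: ab'; rewrite ez -fa' ez fb ltnNge ltnW.
  by apply: same => //; rewrite -fb' ez.
rewrite big_cons permM IH //; last by move=> e eL'; rewrite LE // inE eL' orbT.
rewrite val_ntperm // /endpt /= ![_ == y :> nat]eq_sym.
have [ya|ya] := eqVneq (val y) a; first by rewrite nend ?ya //=; right.
have [yb|yb] := eqVneq (val y) b; first by rewrite nend ?yb //=; left.
by [].
Qed.

End GraphPermutations.

Section Graph.

Variables n i r : nat.
Hypothesis nE : n = (i + r).*2.
Hypothesis i_gt0 : 0 < i.
Hypothesis r_gt5 : 5 < r.

Local Notation rho := (graph_rho n (thm41_edges i r)).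
Local Notation N := (i + r + 2)%N.

(* Label [l] on a terminal-1 alternating path occupying the vertices [o, ..., o + a - 1]. *)
Definition alt_map (l : bool) (o a v : nat) : nat :=
  if o <= v < o + a then
    if odd (o + a - v.+1) != l then (if v == o then v else v.-1)
    else (if v.+1 == o + a then v else v.+1)
  else v.

(** [i + r - 2] is the difference between the vertex numbers of the two ends of either crossing
    edge, that is, of either edge joining a t-point to an s-point; the two cases with [r - 3] are
    the two directions. *)
Definition rho_map (k v : nat) : nat :=
  if k < 2 then
    (if v < N then alt_map (k == 1%N) 0 (i + 4) v else alt_map (k == 1%N) N i v)
  else if [&& k == r - 3, i + r <= v & v < N] then (v + (i + r - 2))%N
  else if [&& k == r - 3 & N + i + r - 4 <= v] then (v - (i + r - 2))%N
  else if v < N then swap_map (i + k + 1) v else swap_map (N + i + k - 3) v.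

(** A repeated edge would make its transposition cancel. In the four path families the first
    endpoint determines the edge, and the crossing edges are told apart by their non-consecutive
    ends. *)
Lemma uniq_edges : uniq (thm41_edges i r).
Proof.
rewrite /thm41_edges 3!catA cat_uniq; apply/and3P; split.
- apply: (@map_uniq _ _ (fun e => e.1.1)); rewrite -!catA !map_cat.
  rewrite !cat_uniq -!map_comp.
  have uf (f : nat -> nat) (m l : nat) :
      {in iota m l &, injective f} -> uniq [seq f j | j <- iota m l].
    by move=> fI; rewrite map_inj_in_uniq ?iota_uniq.
  have hf (f g : nat -> nat) (m l m' l' : nat) :
      (forall x y, m <= x < m + l -> m' <= y < m' + l' -> f x <> g y) ->
      has (mem [seq f j | j <- iota m l]) [seq g j | j <- iota m' l'] = false.
    move=> fg; apply/hasP=> -[z /mapP[y]]; rewrite mem_iota => yI ->.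
    by move=> /mapP[x]; rewrite mem_iota => xI /esym; apply: fg.
  rewrite !has_cat !uf ?hf //= /tv /Defs.sv;
    by move=> x y; rewrite ?mem_iota /=; lia.
- have sE : all (fun e => e.1.2 == e.1.1.+1)
    (((alt_path tv (i + 4) ++ [seq (tv (i + k + 2), tv (i + k + 3), k) | k <- iota 2 (r - 2)])
     ++ alt_path (Defs.sv i r) i) ++
     [seq (Defs.sv i r (i + k - 2), Defs.sv i r (i + k - 1), k) | k <- iota 2 (r - 2)]).
    rewrite -!catA !all_cat; apply/and4P; split;
      by apply/allP=> e /mapP[s]; rewrite mem_iota /tv /Defs.sv => sI -> /=; lia.
  apply/hasP=> -[e eX eA]; have := allP sE e eA; move: eX.
  by rewrite !inE => /orP[] /eqP-> /=; rewrite /tv /Defs.sv; lia.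
by rewrite /= inE; apply/andP; split=> //; apply/eqP; rewrite /tv => -[]; lia.
Qed.

Lemma edges_rho_map k e : e \in thm41_edges i r -> e.2 = k ->
  [/\ e.1.1 < e.1.2 < n, rho_map k e.1.1 = e.1.2 & rho_map k e.1.2 = e.1.1].
Proof.
move=> eE <-; move: eE; rewrite /thm41_edges !mem_cat.
case/or4P=> [/mapP[s]|/mapP[s]|/mapP[s]|/orP[/mapP[s]|]].
- rewrite mem_iota /tv => sI -> /=; rewrite /rho_map /alt_map.
  case: (boolP (odd _)) => os /=; split; try lia;
  by do 6?[case: ifP => ?; try lia].
- rewrite mem_iota /tv => sI -> /=; rewrite /rho_map /swap_map.
  split; try lia; by do 6?[case: ifP => ?; try lia].
- rewrite mem_iota /Defs.sv => sI -> /=; rewrite /rho_map /alt_map.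
  case: (boolP (odd _)) => os /=; split; try lia;
  by do 6?[case: ifP => ?; try lia].
- rewrite mem_iota /Defs.sv => sI -> /=; rewrite /rho_map /swap_map.
  split; try lia; by do 6?[case: ifP => ?; try lia].
rewrite !inE /tv /Defs.sv; case/orP=> /eqP-> /=; rewrite /rho_map;
  split; try lia; by do 6?[case: ifP => ?; try lia].
Qed.

Lemma rho_map_edges k v : k < r -> v < n -> rho_map k v != v ->
  ((v, rho_map k v, k) \in thm41_edges i r) || ((rho_map k v, v, k) \in thm41_edges i r).
Proof.
move=> kr vn; rewrite /thm41_edges !mem_cat.
have mT a b s : 0 < s < i + 4 -> a = s.-1 -> b = s ->
    k = (if odd (i + 4 - s) then 1 else 0)%N -> (a, b, k) \in alt_path tv (i + 4).
  move=> sI -> -> ->; apply/mapP; exists s; rewrite ?mem_iota; first lia.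
  by rewrite /tv.
have mS a b s : 0 < s < i -> a = Defs.sv i r s -> b = Defs.sv i r s.+1 ->
    k = (if odd (i - s) then 1 else 0)%N -> (a, b, k) \in alt_path (Defs.sv i r) i.
  by move=> sI -> -> ->; apply/mapP; exists s; rewrite ?mem_iota //; lia.
have mTk a b : 1 < k -> a = (i + k + 1)%N -> b = (i + k + 2)%N ->
    (a, b, k) \in [seq (tv (i + k + 2), tv (i + k + 3), k) | k <- iota 2 (r - 2)].
  move=> k1 -> ->; apply/mapP; exists k; rewrite ?mem_iota; first lia.
  by rewrite /tv; do 2!congr (_, _); lia.
have mSk a b : 1 < k -> a = Defs.sv i r (i + k - 2) -> b = Defs.sv i r (i + k - 1) ->
    (a, b, k) \in [seq (Defs.sv i r (i + k - 2), Defs.sv i r (i + k - 1), k) | k <- iota 2 (r - 2)].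
  by move=> k1 -> ->; apply/mapP; exists k; rewrite ?mem_iota //; lia.
move: {-1}(rho_map k v) (erefl (rho_map k v)) => w; rewrite /rho_map.
case: ifP => k2.
  case: ifP => vN; rewrite /alt_map; case: ifP => vI; try by move=> <-; rewrite eqxx.
    case: ifP => ov; (case: ifP => v0; first by move=> <-; rewrite eqxx) => wE _.
      by apply/orP; right; rewrite (mT w v v) //; try (case: ifP => ?); lia.
    by apply/orP; left; rewrite (mT v w w) //; try (case: ifP => ?); lia.
  case: ifP => ov; (case: ifP => v0; first by move=> <-; rewrite eqxx) => wE _.
    apply/orP; right; rewrite (mS w v (v - N)%N) ?orbT // /Defs.sv; try (case: ifP => ?); lia.
  apply/orP; left; rewrite (mS v w (v - N).+1) ?orbT // /Defs.sv; try (case: ifP => ?); lia.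
case: ifP => [kr3 wE _|nk1].
  apply/orP; left; rewrite !inE /tv /Defs.sv.
  by apply/orP; right; apply/orP; right; apply/orP; right; apply/orP; right;
     have [vr|vr] := eqVneq v (i + r)%N; apply/orP; [left|right];
     apply/eqP; congr (_, _, _); lia.
case: ifP => [kr3 wE _|nk2].
  apply/orP; right; rewrite !inE /tv /Defs.sv.
  by apply/orP; right; apply/orP; right; apply/orP; right; apply/orP; right;
     have [vr|vr] := eqVneq w (i + r)%N; apply/orP; [left|right];
     apply/eqP; congr (_, _, _); lia.
case: ifP => vN; rewrite /swap_map.
  case: ifP => [v0 wE _|_].
    by rewrite (mTk v w) ?orbT //; lia.
  case: ifP => [v0 wE _|_ <-]; last by rewrite eqxx.
  by apply/orP; right; rewrite (mTk w v) ?orbT //; lia.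
case: ifP => [v0 wE _|_].
  by rewrite (mSk v w) ?orbT // /Defs.sv; lia.
case: ifP => [v0 wE _|_ <-]; last by rewrite eqxx.
by apply/orP; right; rewrite (mSk w v) ?orbT // /Defs.sv; lia.
Qed.

Lemma rho_mapK k v : k < r -> v < n -> rho_map k (rho_map k v) = v.
Proof.
move=> kr vn; have [fv|nfv] := eqVneq (rho_map k v) v; first by rewrite !fv.
by have /orP[] := rho_map_edges kr vn nfv => /edges_rho_map/(_ erefl)[].
Qed.

Lemma val_rho k (x : 'I_n) : k < r -> rho k x = rho_map k x :> nat.
Proof.
move=> kr; apply: val_graph_rho; first exact: uniq_edges.
  by move=> e eE ek; apply: edges_rho_map.
by move=> v vn; apply: rho_map_edges.
Qed.

(** * Blocks *)

(* [beta x] is the index [j] (with [1 <= j <= r]) of the block {t_(i+2+j), s_(i-2+j)}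
   containing [x], and 0 outside the blocks; [side] tells the s-points. If [i = 1] then
   the block of index 1 has no s-point, and [spt 1] is a junk vertex: hence the
   hypotheses [2 < i + _] below. *)
Definition beta (x : 'I_n) : nat := if x < N then (x - i.+1)%N else (x + 3 - (N + i))%N.
Definition side (x : 'I_n) : bool := N <= x.

Fact n_gt0 : 0 < n. Proof. lia. Qed.

(** Numbers outside the range default to vertex 0. *)
Definition vertex (v : nat) : 'I_n := insubd (Ordinal n_gt0) v.
Definition tpt (d : nat) : 'I_n := vertex (i + 1 + d).
Definition spt (d : nat) : 'I_n := vertex (N + i + d - 3).

Lemma val_vertex v : v < n -> vertex v = v :> nat.
Proof. by move=> vn; rewrite /vertex val_insubd vn. Qed.

Lemma val_tpt d : d <= r -> tpt d = (i + 1 + d)%N :> nat.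
Proof. by move=> dr; rewrite val_vertex //; lia. Qed.

Lemma val_spt d : d <= r -> spt d = (N + i + d - 3)%N :> nat.
Proof. by move=> dr; rewrite val_vertex //; lia. Qed.

Lemma beta_le x : beta x <= r.
Proof. by have := ltn_ord x; rewrite /beta; case: ifP; lia. Qed.

Lemma beta_tpt d : d <= r -> beta (tpt d) = d.
Proof. by move=> dr; rewrite /beta val_tpt //; case: ifP; lia. Qed.

Lemma side_tpt d : d <= r -> side (tpt d) = false.
Proof. by move=> dr; rewrite /side val_tpt //; lia. Qed.

Lemma beta_spt d : d <= r -> 2 < i + d -> beta (spt d) = d.
Proof. by move=> dr id; rewrite /beta val_spt //; case: ifP; lia. Qed.

Lemma side_spt d : d <= r -> 2 < i + d -> side (spt d) = true.
Proof. by move=> dr id; rewrite /side val_spt //; lia. Qed.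

Lemma side_beta x : side x -> 0 < beta x -> 2 < i + beta x.
Proof. by rewrite /side /beta; case: ifP; lia. Qed.

Lemma beta_side_inj x y :
  0 < beta x -> beta x = beta y -> side x = side y -> x = y.
Proof.
move=> bx bxy sxy; apply: val_inj => /=; move: bx bxy sxy; rewrite /side /beta.
by case: ifP; case: ifP; lia.
Qed.

Lemma tptE x : ~~ side x -> 0 < beta x -> x = tpt (beta x).
Proof.
move=> sx bx; apply: beta_side_inj => //; rewrite ?beta_tpt ?beta_le //.
by rewrite side_tpt ?beta_le // (negPf sx).
Qed.

Lemma sptE x : side x -> 0 < beta x -> x = spt (beta x).
Proof.
move=> sx bx; have ib := side_beta sx bx.
by apply: beta_side_inj => //; rewrite ?beta_spt ?side_spt ?beta_le.
Qed.

Lemma beta_rho k x : 0 < k < r -> 2 < i + k -> beta (rho k x) = swap_map k (beta x).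
Proof.
move=> k0r ik; have xn := ltn_ord x; rewrite /beta val_rho; last lia.
move: (nat_of_ord x) xn => v vn; have [w wE] : {w | rho_map k v = w} by [exists (rho_map k v)].
rewrite wE; move: wE; rewrite /rho_map /alt_map /swap_map; case: (ltnP v N) => vN;
  by do ?[case: ifP => ?] => wE; lia.
Qed.

Lemma side_rho k x : k < r ->
  side (rho k x) = side x (+) ((k == r - 3) && (r.-1 <= beta x)).
Proof.
move=> kr; have xn := ltn_ord x; rewrite /side val_rho // /beta.
move: (nat_of_ord x) xn => v vn; have [w wE] : {w | rho_map k v = w} by [exists (rho_map k v)].
rewrite wE; move: wE; rewrite /rho_map /alt_map /swap_map; case: (ltnP v N) => vN;
  by do ?[case: ifP => ?] => wE; lia.
Qed.

Lemma rho_low k x : 1 < k < r -> beta x < k -> rho k x = x.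
Proof.
move=> kr; have xn := ltn_ord x; rewrite /beta => bx; apply: val_inj => /=.
rewrite val_rho; last lia.
move: (nat_of_ord x) xn bx => v vn; rewrite /rho_map /swap_map.
by do ?[case: ifP => ?]; lia.
Qed.

Lemma rho_high k x : k < r -> k.+1 < beta x -> (k == r - 3) && (r.-1 <= beta x) = false ->
  rho k x = x.
Proof.
move=> kr; have xn := ltn_ord x; rewrite /beta => bx ne; apply: val_inj => /=.
rewrite val_rho //.
move: (nat_of_ord x) xn bx ne => v vn; rewrite /rho_map /alt_map /swap_map.
by do ?[case: ifP => ?]; lia.
Qed.

Lemma rhoK k : k < r -> involutive (rho k).
Proof. by move=> kr x; apply: val_inj; rewrite /= !val_rho // rho_mapK. Qed.

Lemma rho2 k : k < r -> rho k * rho k = 1.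
Proof. by move=> kr; apply/permP=> x; rewrite permM rhoK ?perm1. Qed.

(** For [j != r - 3] the moved points are separated: those of [rho k] have [beta] at least [k],
    those of [rho j] at most [j + 1]. For [j = r - 3] only [k = r - 1] remains, and both products
    are compared by block and side. *)
Lemma commute_rho j k : j < r -> k < r -> j + 2 <= k -> commute (rho j) (rho k).
Proof.
move=> jr kr jk; have [jr3|jr3] := eqVneq j (r - 3)%N; last first.
  apply: commute_disjoint => x; have [xj|xj] := leqP (beta x) j.+1.
    by right; apply: rho_low; lia.
  by left; apply: rho_high; rewrite // (negPf jr3).
have kr1 : k = r.-1 by lia.
have beta_jk x : beta (rho j (rho k x)) = beta (rho k (rho j x)).
  by rewrite !beta_rho /swap_map; try lia; case_ifs; lia.
apply/permP=> x; rewrite !permM; have [x0|x0] := posnP (beta x).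
  rewrite !(@rho_low k) ?(@rho_low j) //; lia.
apply: beta_side_inj; first by rewrite !beta_rho /swap_map; try lia; case_ifs; lia.
  by rewrite beta_jk.
by rewrite !side_rho // !beta_rho /swap_map; try lia; case_ifs; lia.
Qed.

Lemma odd_graph_rho (E : seq (nat * nat * nat)) k :
  all (fun e => e.1.1 < e.1.2 < n) E ->
  odd_perm (graph_rho n E k) = odd (count (fun e => e.2 == k) E).
Proof.
rewrite /graph_rho; elim: E => [|e E IH] /=; first by rewrite big_nil odd_perm1.
case/andP=> /andP[ab bn] /IH {}IH; rewrite big_cons; case: ifP => _ //=.
have an := ltn_trans ab bn.
rewrite odd_permM IH (ntpermE an bn) odd_tperm -val_eqE /= neq_ltn ab /=.
by rewrite oddD.
Qed.

(** The alternating t-path has the labels of the s-path preceded by four edges, two of label 0 and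
    two of label 1. Each label from 2 to [r - 1] occurs once along either family of points, and the
    crossing edges form a pair. *)
Lemma even_rho k : ~~ odd_perm (rho k).
Proof.
rewrite odd_graph_rho; last first.
  by apply/allP=> e /edges_rho_map/(_ erefl)[].
rewrite /thm41_edges !count_cat /alt_path.
have -> : iota 1 (i + 4).-1 = ([:: 1; 2; 3; 4] ++ [seq 4 + s | s <- iota 1 i.-1])%N.
  by rewrite -iotaDl -(iotaD 1 4); congr iota; lia.
rewrite !count_map /= count_map.
set u := count _ (iota 1 i.-1); set u' := count _ (iota 1 i.-1).
have -> : u = u' by apply: eq_count => s /=; have -> : (i + 4 - (4 + s) = i - s)%N by lia.
set w := count _ (iota 2 _).
have -> : ((i + 4 - 1) = i.+3)%N by lia.
have -> : ((i + 4 - 2) = i.+2)%N by lia.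
have -> : ((i + 4 - 3) = i.+1)%N by lia.
have -> : ((i + 4 - 4) = i)%N by lia.
move: (u') (w) => a b /=; case: (odd i) => /=; lia.
Qed.

(** * Action of the interval groups on blocks and sides *)

Local Notation Gam a b := (gens_group rho (interval r a b)).

Lemma mem_rho a b k : a <= k < b -> k < r -> rho k \in Gam a b.
Proof.
move=> kab kr; apply: (@mem_gens _ _ _ _ (Ordinal kr)).
by rewrite inE.
Qed.

Lemma Gam_rect a b (P : {perm 'I_n} -> Prop) :
  P 1 -> (forall g k, P g -> a <= k < b -> k < r -> P (g * rho k)) ->
  forall g, g \in Gam a b -> P g.
Proof.
move=> P1 PM; apply: gens_group_rect => // g k Pg; rewrite inE => kab.
exact: PM.
Qed.

Lemma GamS a b a' b' g : a' <= a -> b <= b' -> g \in Gam a b -> g \in Gam a' b'.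
Proof. by move=> aa bb; apply/gens_groupP/intervalS. Qed.

Lemma Gam_even a b g : g \in Gam a b -> ~~ odd_perm g.
Proof.
move: g; apply: Gam_rect => [|g k eg _ _]; first by rewrite odd_perm1.
by rewrite odd_permM (negPf eg) (negPf (even_rho k)).
Qed.

Lemma beta_rho_le m k x : k < m -> k < r -> beta x <= m -> beta (rho k x) <= m.
Proof.
move=> km kr xm; have [k2|k2] := leqP 2 k.
  by rewrite beta_rho /swap_map; try lia; case_ifs; lia.
rewrite leqNgt; apply/negP=> my.
suff xy : rho k x = x by move: my; rewrite xy ltnNge xm.
by apply/(@perm_inj _ (rho k))/rho_high; lia.
Qed.

Lemma Gam_tip a b g x : b < r -> g \in Gam a b -> beta x = b.+1 -> beta (g x) = b.+1.
Proof.
move=> br gG; move: g gG x; apply: Gam_rect => [x|g k IH kab kr x xb]; first by rewrite perm1.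
rewrite permM; move: (IH x xb); move: (g x) => y yb.
have [k2|k2] := leqP 2 k; last by rewrite rho_high //; lia.
by rewrite beta_rho /swap_map; try lia; case_ifs; lia.
Qed.

(* The action of the coset representative [rho b * rho b.-1 * ... * rho j] on blocks. *)
Definition cyc_map (j b d : nat) : nat :=
  if d == b.+1 then j else if j <= d <= b then d.+1 else d.

(** Coset decomposition in the symmetric group of the blocks [a], ..., [b + 1]: a new generator on
    the right either passes through the cycle to [h], its index dropping by one if it exceeds [j],
    or changes [j] by one. *)
Lemma beta_coset a b g : 0 < a -> a <= b < r -> 2 < i + a -> g \in Gam a b.+1 ->
  exists h j, [/\ h \in Gam a b, a <= j <= b.+1 &
    forall x, beta (g x) = cyc_map j b (beta (h x))].
Proof.
move=> a0 abr ia; move: g; apply: Gam_rect => [|g k [h [j [hG jab gE]]] kab kr].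
  exists 1, b.+1; split=> [||x]; [exact: group1 | lia |].
  by rewrite !perm1 /cyc_map; case_ifs; lia.
have gkE x : beta ((g * rho k) x) = swap_map k (cyc_map j b (beta (h x))).
  by rewrite permM beta_rho ?gE; lia.
have [kj|jk] := ltnP k.+1 j.
  exists (h * rho k), j; split=> // [|x].
    by apply: groupM => //; apply: mem_rho => //; lia.
  rewrite gkE permM beta_rho; try lia.
  by rewrite /swap_map /cyc_map; case_ifs; lia.
have [kj|kj] := eqVneq k.+1 j.
  exists h, k; split=> // [|x]; first lia.
  by rewrite gkE /swap_map /cyc_map; case_ifs; lia.
have [ekj|nkj] := eqVneq k j.
  exists h, j.+1; split=> // [|x]; first lia.
  by rewrite gkE /swap_map /cyc_map; case_ifs; lia.
exists (h * rho k.-1), j; split=> // [|x].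
  by apply: groupM => //; apply: mem_rho; lia.
rewrite gkE permM beta_rho; try lia.
by rewrite /swap_map /cyc_map; case_ifs; lia.
Qed.

Lemma beta_stab a b g : 0 < a -> a <= b < r -> 2 < i + a -> g \in Gam a b.+1 ->
  (forall x, beta x = b.+1 -> beta (g x) = b.+1) ->
  exists2 h, h \in Gam a b & forall x, beta (g x) = beta (h x).
Proof.
move=> a0 abr ia gG gtip; have [h [j [hG jab gE]]] := beta_coset a0 abr ia gG.
exists h => // x; have bt : beta (tpt b.+1) = b.+1 by apply: beta_tpt; lia.
have br : b < r by lia.
have := gE (tpt b.+1); rewrite gtip // (Gam_tip br hG bt) /cyc_map eqxx => ej.
by rewrite gE /cyc_map -ej; case_ifs; lia.
Qed.

Lemma Gam_low a b g x : 1 < a -> g \in Gam a b -> beta x < a -> g x = x.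
Proof.
move=> a1 gG; move: g gG x; apply: Gam_rect => [x|g k IH kab kr x xa]; first by rewrite perm1.
by rewrite permM IH // rho_low //; lia.
Qed.

Lemma Gam_side a b g x : (b <= r - 3) || (r - 3 < a) -> g \in Gam a b ->
  side (g x) = side x.
Proof.
move=> abr gG; move: g gG x; apply: Gam_rect => [x|g k IH kab kr x]; first by rewrite perm1.
rewrite permM side_rho // IH.
have -> : (k == r - 3) = false by lia.
by rewrite /= addbF.
Qed.

(** [rho (r - 3)] changes sides only in the last two blocks, which labels below [r - 2] do not mix
    with the others. *)
Lemma Gam_side_low a g x : g \in Gam a (r - 2) -> beta x <= r - 2 ->
  (beta (g x) <= r - 2) && (side (g x) == side x).
Proof.
move=> gG; move: g gG x; apply: Gam_rect => [x xr|g k IH kab kr x xr].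
  by rewrite perm1 xr eqxx.
rewrite permM; case/andP: (IH x xr); move: (g x) => y yr /eqP<-.
rewrite beta_rho_le //=; last lia.
rewrite side_rho //; have -> : (r.-1 <= beta y) = false by lia.
by rewrite andbF addbF.
Qed.

(* [side x (+) (beta x == r - 3)] separates {s_(i+r-5), t_(i+r), t_(i+r+1), t_(i+r+2)}
   from the other four points of the last four blocks; these generators preserve or
   exchange the two halves. This rules out flipping exactly two of these blocks. *)
Lemma Gam_transversal g : g \in Gam (r - 3) r -> exists e, forall x, r - 3 <= beta x ->
  (r - 3 <= beta (g x)) &&
  (side (g x) (+) (beta (g x) == r - 3)%N == side x (+) (beta x == r - 3)%N (+) e).
Proof.
move: g; apply: Gam_rect => [|g k [e IH] kab kr].
  by exists false => x xr; rewrite perm1 xr addbF eqxx.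
exists (e (+) (k == r - 3)%N) => x xr; case/andP: (IH x xr); rewrite permM.
move: (g x) => y yr /eqP; rewrite addbA => <-.
rewrite side_rho // beta_rho; try lia; rewrite /swap_map.
by case: (side y) => /=; case_ifs; lia.
Qed.

(** * Cubes of products of consecutive generators, and block flips *)

Definition cube_rho k := (rho k * rho k.+1) ^+ 3.

Lemma cube_rhoE k x :
  cube_rho k x = rho k.+1 (rho k (rho k.+1 (rho k (rho k.+1 (rho k x))))).
Proof. by rewrite /cube_rho !expgS expg0 mulg1 !permM. Qed.

Lemma mem_cube_rho a b k : a <= k -> k.+1 < b -> k.+1 < r -> cube_rho k \in Gam a b.
Proof.
by move=> ak kb kr; apply: groupX; apply: groupM; apply: mem_rho; lia.
Qed.

Definition rot3 (k d : nat) : nat :=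
  if d == k then k.+2 else if d == k.+1 then k else if d == k.+2 then k.+1 else d.

Lemma beta_rot k x : 0 < k -> k.+1 < r -> 2 < i + k ->
  beta (rho k.+1 (rho k x)) = rot3 k (beta x).
Proof.
by move=> k0 kr ik; rewrite !beta_rho /swap_map /rot3; try lia; case_ifs; lia.
Qed.

Lemma beta_cube_rho k x : 0 < k -> k.+1 < r -> 2 < i + k ->
  beta (cube_rho k x) = beta x.
Proof.
by move=> k0 kr ik; rewrite cube_rhoE !beta_rot // /rot3; case_ifs; lia.
Qed.

Lemma side_rot k x : r - 4 <= k <= r - 3 ->
  side (rho k.+1 (rho k x)) = side x (+) (r.-1 <= beta x).
Proof.
move=> kr; rewrite !side_rho ?beta_rho /swap_map; try lia.
by case: (side x) => /=; case_ifs; lia.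
Qed.

(** Each factor rotates three blocks and flips whatever starts in the blocks [r - 1] and [r]. For
    [k = r - 4] these two are flipped three times; for [k = r - 3] each of the three rotated blocks
    is in place [r - 1] exactly once, and block [r] is flipped three times. *)
Lemma side_cube_rho k x : r - 4 <= k <= r - 3 ->
  side (cube_rho k x) = side x (+) ((if k == r - 3 then r - 3 else r.-1) <= beta x)%N.
Proof.
move=> kr; rewrite cube_rhoE !side_rot // !beta_rot; try lia.
by rewrite /rot3; case: (side x) => /=; case_ifs; lia.
Qed.

Lemma cube_rho_low k x : 1 < k -> k.+1 < r -> beta x < k -> cube_rho k x = x.
Proof. by move=> k1 kr xk; rewrite cube_rhoE !(rho_low (x := x)) //; lia. Qed.

Lemma Gam_sub_Alt a b : Gam a b \subset 'Alt_('I_n).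
Proof. by apply/subsetP=> g /Gam_even; rewrite Alt_even. Qed.

Lemma block_trivial (u : {perm 'I_n}) c : 0 < c -> (forall x, beta (u x) = beta x) ->
  (forall x, beta x < c -> u x = x) ->
  (forall x, c <= beta x -> side (u x) = side x) -> u = 1.
Proof.
move=> c0 bu lu su; apply/permP=> x; rewrite perm1.
have [/lu//|cx] := ltnP (beta x) c.
by apply: beta_side_inj; rewrite ?bu ?su // (leq_trans c0).
Qed.

Lemma side_block (u : {perm 'I_n}) x y : beta (u x) = beta x -> beta (u y) = beta y ->
  0 < beta x -> beta x = beta y -> side (u x) (+) side x = side (u y) (+) side y.
Proof.
move=> bux buy bx bxy; have [sxy|sxy] := eqVneq (side x) (side y).
  by rewrite (beta_side_inj bx bxy sxy).
suff : side (u x) != side (u y).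
  by move: sxy; case: (side x); case: (side y); case: (side (u x)); case: (side (u y)).
apply: contra sxy => /eqP su; apply/eqP; congr side.
by apply/(@perm_inj _ u)/beta_side_inj; rewrite ?bux ?buy.
Qed.

(** Block [r] serves as common partner, so that these flips generate all the even ones. *)
Definition block_flip (j : nat) (h : {perm 'I_n}) : Prop := forall x,
  [/\ beta (h x) = beta x, beta x = 0%N -> h x = x &
      side (h x) = side x (+) ((beta x == j) || (beta x == r))].

(** The blocks are corrected one after the other from [c] upwards, the defect being pushed to block
    [r], where evenness excludes a single remaining flip. *)
Lemma mem_block_flip (H : {group {perm 'I_n}}) c (u : {perm 'I_n}) :
  0 < c <= r -> 2 < i + c ->
  (forall j, c <= j < r -> exists2 h, h \in H & ~~ odd_perm h /\ block_flip j h) ->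
  ~~ odd_perm u -> (forall x, beta (u x) = beta x) ->
  (forall x, beta x < c -> u x = x) -> u \in H.
Proof.
have [m] := ubnP (r - c); elim: m c u => // m IH c u; rewrite ltnS.
move=> rcm /andP[c0 cr] ic Hflip eu bu lu.
have [rc|{}cr] := leqP r c.
  suff -> : u = 1 by rewrite group1.
  apply: (@even_fix_but_two _ (tpt r) (spt r)) => // x xt xs.
  apply: lu; apply: leq_trans rc; rewrite ltn_neqAle beta_le andbT.
  apply/eqP=> xr; case: (boolP (side x)) => sx.
    by case/eqP: xs; rewrite {1}(sptE sx) xr //; lia.
  by case/eqP: xt; rewrite {1}(tptE sx) xr //; lia.
have IHc (v : {perm 'I_n}) : ~~ odd_perm v -> (forall x, beta (v x) = beta x) ->
    (forall x, beta x < c.+1 -> v x = x) -> v \in H.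
  by apply: IH; try lia; move=> j jr; apply: Hflip; lia.
have bt : beta (tpt c) = c by apply: beta_tpt; lia.
have blk (v : {perm 'I_n}) x : (forall x, beta (v x) = beta x) -> beta x = c ->
    side (v (tpt c)) = false -> v x = x.
  move=> bv xc svt; apply: beta_side_inj; rewrite ?bv ?xc //.
  have := side_block (bv x) (bv (tpt c)); rewrite xc bt svt side_tpt; last lia.
  by move=> /(_ c0 erefl); case: (side (v x)); case: (side x).
case su: (side (u (tpt c))); last first.
  by apply: IHc => // x; rewrite ltnS leq_eqVlt => /orP[/eqP/blk|/lu] //; apply.
have [h hH [eh hf]] : exists2 h, h \in H & ~~ odd_perm h /\ block_flip c h.
  by apply: Hflip; lia.
rewrite -[u](mulgK h) groupM ?groupV //; apply: IHc.
- by rewrite odd_permM (negPf eu) (negPf eh).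
- by move=> x; rewrite permM; case: (hf (u x)) => -> _ _; rewrite bu.
move=> x; rewrite ltnS leq_eqVlt => /orP[/eqP xc|xc].
  apply: blk => //; first by move=> y; rewrite permM; case: (hf (u y)) => ->.
  by rewrite permM; case: (hf (u (tpt c))) => _ _ ->; rewrite su bu bt eqxx.
rewrite permM lu //; have [bh h0 sh] := hf x.
have [/h0//|x0] := posnP (beta x).
apply: beta_side_inj; rewrite ?bh // sh.
have -> : (beta x == c) = false by lia.
have -> : (beta x == r) = false by lia.
by rewrite addbF.
Qed.

Lemma block_flip_cube : block_flip r.-1 (cube_rho (r - 4)).
Proof.
move=> x; split; first by apply: beta_cube_rho; lia.
  by move=> x0; apply: cube_rho_low; lia.
rewrite side_cube_rho; last lia.
by have := beta_le x; case: (side x) => /=; case_ifs; lia.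
Qed.

(** Downwards from [j = r - 1]: conjugation by [rho j] carries the flip of the blocks [j + 1] and
    [r] to that of [j] and [r]. *)
Lemma Gam_block_flip a j : 0 < a <= r - 4 -> 2 < i + a -> a <= j < r ->
  exists2 h, h \in Gam a r.-1 & ~~ odd_perm h /\ block_flip j h.
Proof.
move=> ar ia; have [m] := ubnP (r - j); elim: m j => // m IH j; rewrite ltnS => rjm jr.
have [ej|nj] := eqVneq j r.-1.
  have hG : cube_rho (r - 4) \in Gam a r.-1 by apply: mem_cube_rho; lia.
  exists (cube_rho (r - 4)) => //; split; first exact: Gam_even hG.
  by rewrite ej; apply: block_flip_cube.
have [h hG [eh hf]] : exists2 h, h \in Gam a r.-1 & ~~ odd_perm h /\ block_flip j.+1 h.
  by apply: IH; lia.
have jG : rho j \in Gam a r.-1 by apply: mem_rho; lia.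
exists (rho j * h * rho j); first by rewrite !groupM.
split; first by rewrite !odd_permM (negPf eh) addbF addbb.
move=> x; rewrite !permM; have [bh h0 sh] := hf (rho j x).
have bjx : beta (rho j x) = swap_map j (beta x) by rewrite beta_rho //; lia.
split.
- by rewrite beta_rho ?bh ?bjx ?swap_mapK //; lia.
- by move=> x0; rewrite h0 ?rhoK ?bjx ?x0 ?swap_map_low //; lia.
rewrite side_rho; last lia.
rewrite sh bh side_rho; last lia.
rewrite bjx swap_map_high; last lia.
rewrite swap_map_eq; last lia.
by case: (side x); case: (_ && _); case: (_ || _).
Qed.

(** Here [u] only flips blocks; which flips are possible depends on the position of [r - 3] relative
    to [a] and [b]. *)
Lemma Gam_inter_kernel a b u : 0 < a -> a <= b < r -> 2 < i + a ->
  u \in Gam a b.+1 -> u \in Gam a.-1 b -> (forall x, beta (u x) = beta x) ->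
  (forall x, beta x < a -> u x = x) -> u \in Gam a b.
Proof.
move=> a0 abr ia uG uG' bu lu.
(* One of the two groups avoids the label [r - 3] and preserves all sides. *)
case: (boolP ((b <= r - 3) || (r - 3 < a))) => abr3.
  suff -> : u = 1 by rewrite group1.
  apply: (block_trivial a0 bu lu) => x _; case/orP: abr3 => abr3.
    by apply: Gam_side uG'; rewrite abr3.
  by apply: Gam_side uG; rewrite abr3 orbT.
(* For [a = r - 3] either all of the last four blocks are flipped or none is. Flipping all is
   impossible for [b = r - 2], and for [b = r - 1] it is a cube in the group. *)
have [ar3|ar3] := eqVneq a (r - 3)%N.
  have [e eE] : exists e, forall x, r - 3 <= beta x -> side (u x) = side x (+) e.
    have [|e eE] := @Gam_transversal u; first by apply: GamS uG; lia.
    exists e => x xr; case/andP: (eE x xr) => _ /eqP; rewrite bu.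
    by case: (_ == _); case: (side x); case: (side (u x)); case: e {eE}.
  case: e eE => eE; last first.
    suff -> : u = 1 by rewrite group1.
    by apply: (block_trivial a0 bu lu) => x; rewrite ar3 => /eE->; rewrite addbF.
  have [br|br] := eqVneq b (r - 2)%N.
    have bt : beta (tpt (r - 3)) = (r - 3)%N by apply: beta_tpt; lia.
    move: uG'; rewrite br => /(@Gam_side_low _ _ (tpt (r - 3))).
    rewrite eE bt ?leqnn // => /(_ _)/andP[]; first lia.
    by move=> _; rewrite addbT; case: (side _).
  have -> : u = cube_rho (r - 3).
    apply/permP=> x; have [xr|xr] := ltnP (beta x) (r - 3).
      by rewrite lu ?ar3 // cube_rho_low //; lia.
    apply: beta_side_inj; rewrite ?bu; first lia.
      by rewrite beta_cube_rho //; lia.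
    rewrite eE // side_cube_rho; last lia.
    by rewrite eqxx xr.
  by apply: mem_cube_rho; lia.
(* For [b = r - 2] only the last two blocks can be flipped, hence both or neither. *)
have [br|br] := eqVneq b (r - 2)%N.
  apply: (@mem_block_flip _ r.-1) => //; try lia; last 2 first.
  - exact: Gam_even uG.
  - move=> x xr; have [/lu//|ax] := ltnP (beta x) a.
    apply: beta_side_inj; rewrite ?bu //; first lia.
    move: uG'; rewrite br => /(@Gam_side_low _ _ x)/(_ _)/andP[]; first lia.
    by move=> _ /eqP.
  move=> j jr; have -> : j = r.-1 by lia.
  have hG : cube_rho (r - 4) \in Gam a b by apply: mem_cube_rho; lia.
  exists (cube_rho (r - 4)) => //; split; first exact: Gam_even hG.
  exact: block_flip_cube.
(* Now [b = r - 1] and [a <= r - 4], so every even flip is available. *)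
apply: (@mem_block_flip _ a) => //; try lia; last exact: Gam_even uG.
have -> : b = r.-1 by lia.
by move=> j jr; apply: Gam_block_flip; lia.
Qed.

(** * Intersections of interval groups in the general case *)

Lemma Gam_12 (g : {perm 'I_n}) : g \in Gam 1 2 -> g = 1 \/ g = rho 1.
Proof.
move: g; apply: Gam_rect => [|g k gE kI kr]; first by left.
have -> : k = 1%N by lia.
by case: gE => ->; [right; rewrite mul1g | left; rewrite rho2 //; lia].
Qed.

Lemma dihedral_Gam (g : {perm 'I_n}) : g \in Gam 0 2 ->
  (rho 0 * rho 1) ^ g = rho 0 * rho 1 \/ (rho 0 * rho 1) ^ g = rho 1 * rho 0.
Proof.
have V k : k < r -> (rho k)^-1 = rho k.
  by move=> kr; apply: (mulgI (rho k)); rewrite mulgV rho2.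
have r01 : (0 < r) && (1 < r) by lia.
case/andP: r01 => r0 r1.
move: g; apply: Gam_rect => [|g k gE kI kr]; first by left; rewrite conjg1.
rewrite conjgM; have [->|->] : k = 0%N \/ k = 1%N by lia.
  case: gE => ->; [right|left]; rewrite conjgE V //.
    by rewrite !mulgA rho2 // mul1g.
  by rewrite -!mulgA rho2 // mulg1.
case: gE => ->; [right|left]; rewrite conjgE V //.
  by rewrite -!mulgA rho2 // mulg1.
by rewrite !mulgA rho2 // mul1g.
Qed.

(** Labels above 1 fix every point outside the blocks, and [rho 1] permutes these points among
    themselves. *)
Lemma Gam_outside g : 1 < i -> g \in Gam 1 r ->
  (forall x, beta x = 0%N -> g x = x) \/ (forall x, beta x = 0%N -> g x = rho 1 x).
Proof.
move=> i1; move: g; apply: Gam_rect => [|g k gE kI kr].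
  by left=> x _; rewrite perm1.
have b1 x : beta x = 0%N -> beta (rho 1 x) = 0%N.
  by move=> x0; rewrite beta_rho ?x0 //; lia.
have [->|k1] := eqVneq k 1%N.
  case: gE => gE; [right|left] => x x0; rewrite permM gE //.
  by rewrite rhoK //; lia.
case: gE => gE; [left|right] => x x0; rewrite permM gE // rho_low ?b1 ?x0 //; lia.
Qed.

(* Since [u] centralises or inverts [rho 0 * rho 1] and fixes the end of its cycle, it
   would have to fix or reflect the whole cycle; two points near the end exclude both. *)
Lemma Gam_02_outside (u : {perm 'I_n}) : u \in Gam 0 2 ->
  (forall x, beta (u x) = beta x) -> ~ (forall x, beta x = 0%N -> u x = rho 1 x).
Proof.
move=> uG bu u0; have fixb x : 0 < beta x -> u x = x.
  move=> x0; apply: beta_side_inj; rewrite ?bu //.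
  by apply: Gam_side uG; lia.
have [r0 r1] : 0 < r /\ 1 < r by lia.
have bt d : d <= 2 -> beta (tpt d) = d by move=> d2; apply: beta_tpt; lia.
pose w := rho 0 (tpt 1).
have vw : w = i.+1 :> nat.
  rewrite val_rho // val_tpt; last lia.
  by rewrite /rho_map /alt_map; case_ifs; lia.
have bw : beta w = 0%N by rewrite /beta vw; case: ifP; lia.
have vw1 : rho 1 w = i :> nat.
  by rewrite val_rho // vw /rho_map /alt_map; case_ifs; lia.
have r1t2 : rho 1 (tpt 2) = tpt 1.
  apply: val_inj; rewrite /= val_rho // !val_tpt; try lia.
  by rewrite /rho_map /alt_map; case_ifs; lia.
have r0t2 : rho 0 (tpt 2) = tpt 2.
  apply: val_inj; rewrite /= val_rho // !val_tpt; try lia.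
  by rewrite /rho_map /alt_map; case_ifs; lia.
have [cu|cu] := dihedral_Gam uG; move: (conjgC (rho 0 * rho 1) u); rewrite cu.
  move/permP/(_ (tpt 1)); rewrite !permM (fixb (tpt 1)) ?bt // -/w.
  rewrite u0; last first.
    by rewrite /beta vw1; case: ifP; lia.
  by rewrite rhoK // => /(congr1 val) /=; rewrite vw vw1; lia.
move/permP/(_ (tpt 2)); rewrite !permM r0t2 r1t2 (fixb (tpt 1)) ?(fixb (tpt 2)) ?bt // r1t2.
by move/(congr1 beta); rewrite -/w bw bt.
Qed.

(* As [g] stabilises the last block moved by its group, it acts on the blocks like some
   [h] of the smaller group; [u = h^-1 * g] then only flips blocks. When [a = 1], [u] may
   also act as [rho 1] outside the blocks, which [(rho 1 * rho 2) ^+ 3] corrects. *)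
Lemma Gam_inter_blocks a b g : 0 < a -> a <= b < r -> 2 < i + a ->
  g \in Gam a b.+1 -> g \in Gam a.-1 b -> g \in Gam a b.
Proof.
move=> a0 abr ia gG gG'.
have br : b < r by lia.
have [h hG hE] : exists2 h, h \in Gam a b & forall x, beta (g x) = beta (h x).
  by apply: beta_stab => // x; apply: Gam_tip gG'.
pose u := h^-1 * g.
have uG : u \in Gam a b.+1 by apply: groupM => //; apply/groupVr/(GamS _ _ hG).
have uG' : u \in Gam a.-1 b.
  by apply: groupM => //; apply/groupVr/(GamS _ _ hG) => //; apply: leq_pred.
have bu x : beta (u x) = beta x by rewrite permM hE permKV.
suff uH : u \in Gam a b by rewrite -[g](mulKVg h) groupM.
have [a1|a1] := ltnP 1 a.
  by apply: Gam_inter_kernel => // x; apply: Gam_low uG.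
have ea : a = 1%N by lia.
have fix0 (v : {perm 'I_n}) : v \in Gam a b.+1 -> v \in Gam a.-1 b ->
    (forall x, beta (v x) = beta x) -> (forall x, beta x = 0%N -> v x = x) ->
    v \in Gam a b.
  by move=> vG vG' bv v0; apply: Gam_inter_kernel => // x xa; apply: v0; lia.
have [u0|u0] : (forall x, beta x = 0%N -> u x = x) \/
    (forall x, beta x = 0%N -> u x = rho 1 x).
  by apply: Gam_outside; [lia | apply: GamS uG; lia].
  exact: fix0.
(* The correction [cube_rho 1] lies in [Gam 1 b] only from [b = 3] on, so [b = 1] and [b = 2] are
   treated separately. *)
have [eb|b1] := eqVneq b 1%N.
  move: uG; rewrite ea eb => /Gam_12[u1|u1]; first by rewrite u1 group1.
  have := bu (tpt 1); rewrite u1 beta_rho ?beta_tpt //; lia.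
have [eb|b2] := eqVneq b 2%N.
  by exfalso; apply: (Gam_02_outside _ bu u0); rewrite ea eb in uG'.
have zG : cube_rho 1 \in Gam a b by apply: mem_cube_rho; lia.
have zE x : beta x = 0%N -> cube_rho 1 x = rho 1 x.
  move=> x0; have bx : beta (rho 1 x) = 0%N by rewrite beta_rho ?x0 //; lia.
  by rewrite cube_rhoE !(@rho_low 2) ?(rhoK _ x) ?bx //; lia.
rewrite -[u](mulgK (cube_rho 1)); apply: groupM; last exact: groupVr.
apply: fix0.
- by apply: groupM => //; apply: GamS zG.
- by apply: groupM => //; apply: GamS zG; lia.
- by move=> x; rewrite permM beta_cube_rho ?bu //; lia.
move=> x x0; have bx : beta (rho 1 x) = 0%N by rewrite beta_rho ?x0 //; lia.
by rewrite permM u0 // zE // rhoK //; lia.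
Qed.

(** * The case i = 1 *)

Lemma rho_tpt k : 1 < k < r -> rho k (tpt k) = tpt k.+1.
Proof.
move=> kr; apply: val_inj; rewrite /= val_rho ?val_tpt; try lia.
by rewrite /rho_map /swap_map; case_ifs; lia.
Qed.

Lemma rho_spt k : 1 < k < r -> rho k (spt k) = spt k.+1.
Proof.
move=> kr; apply: val_inj; rewrite /= val_rho ?val_spt; try lia.
by rewrite /rho_map /swap_map; case_ifs; lia.
Qed.

Lemma neq_beta x y : beta x != beta y -> x != y.
Proof. by apply: contraNneq => ->. Qed.

Lemma neq_side x y : side x != side y -> x != y.
Proof. by apply: contraNneq => ->. Qed.

Lemma rho_tperm k : 1 < k < r -> k != (r - 3)%N ->
  rho k = tperm (tpt k) (tpt k.+1) * tperm (spt k) (spt k.+1).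
Proof.
move=> kr kr3; have st d d' : d <= r -> 1 < d' <= r -> spt d' != tpt d.
  by move=> dr dr'; apply: neq_side; rewrite side_spt ?side_tpt //; lia.
apply/permP=> x; rewrite permM; case: (@tpermP _ (tpt k) (tpt k.+1) x) => [->|->|xt xt'].
- by rewrite rho_tpt // tpermD // st; lia.
- have -> : rho k (tpt k.+1) = tpt k by rewrite -rho_tpt // rhoK //; lia.
  by rewrite tpermD // st; lia.
case: (@tpermP _ (spt k) (spt k.+1) x) => [->|->|xs xs'].
- by rewrite rho_spt.
- by rewrite -{1}rho_spt // rhoK //; lia.
have k0 : 0 < k by lia.
have xE d : 0 < d -> beta x = d -> x = tpt d \/ x = spt d.
  move=> d0 xd; case: (boolP (side x)) => sx.
    by right; rewrite {1}(sptE sx) xd.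
  by left; rewrite {1}(tptE sx) xd.
have [xk|xk] := ltnP (beta x) k; first by rewrite rho_low.
have [xk'|xk'] := ltnP k.+1 (beta x).
  by rewrite rho_high ?(negPf kr3) //; lia.
have [ek|nk] := eqVneq (beta x) k; first by have [] := xE k k0 ek.
have ek' : beta x = k.+1 by lia.
by have [] := xE k.+1 isT ek'.
Qed.

(** For [b <= r - 3] the blocks above [b] are fixed pointwise; for [b = r - 2] the last two blocks
    are flipped together or not at all, and [cube_rho (r - 4)] undoes the flip. *)
Lemma Gam_high b g : b <= r - 2 -> g \in Gam 0 b ->
  exists2 h, h \in Gam 1 b & forall x, b < beta x -> (g * h) x = x.
Proof.
move=> br gG; have [br3|br3] := leqP b (r - 3).
  exists 1; first exact: group1.
  move=> x; rewrite mulg1; move: g gG x; apply: Gam_rect => [x|g k IH kb kr x xb].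
    by rewrite perm1.
  by rewrite permM IH // rho_high //; lia.
have eb : b = (r - 2)%N by lia.
have [e eE] : exists e, forall x, b < beta x ->
    beta (g x) = beta x /\ side (g x) = side x (+) e.
  move: g gG; apply: Gam_rect => [|g k [e IH] kb kr].
    by exists false => x _; rewrite perm1 addbF.
  exists (e (+) (k == r - 3)%N) => x xb; case: (IH x xb); rewrite permM.
  move: (g x) => y yb ys; rewrite side_rho // ys -addbA.
  have -> : (r.-1 <= beta y) = true by lia.
  rewrite andbT; split=> //; have [k3|k3] := eqVneq k (r - 3)%N.
    by rewrite beta_rho ?yb /swap_map; try lia; case_ifs; lia.
  by rewrite rho_high ?(negPf k3) //; lia.
have fixE (h : {perm 'I_n}) : (forall x, b < beta x -> beta (h x) = beta x) ->
    (forall x, b < beta x -> side (h x) = side x (+) e) ->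
    forall x, b < beta x -> (g * h) x = x.
  move=> bh sh x xb; have [bg sg] := eE x xb; rewrite permM.
  by apply: beta_side_inj; rewrite ?bh ?sh ?bg ?sg ?addbK //; lia.
case: e eE fixE => eE fixE.
  exists (cube_rho (r - 4)); first by apply: mem_cube_rho; lia.
  apply: fixE => x xb; first by apply: beta_cube_rho; lia.
  rewrite side_cube_rho; last lia.
  by have -> : (r - 4 == r - 3)%N = false by [lia]; have -> : (r.-1 <= beta x) = true by lia.
exists 1; first exact: group1.
by apply: fixE => x xb; rewrite perm1 ?addbF.
Qed.

Section Degenerate.

Hypothesis i1 : i = 1%N.

(** For [i = 1] the points [t_3], [t_2] and [t_1] are exactly those outside the blocks, and [rho 1]
    is [(t_4 t_5)(t_2 t_3)]. *)
Let p := vertex 2.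
Let q := vertex 1.
Let v0 := vertex 0.

Lemma val_p : p = 2%N :> nat. Proof. by rewrite val_vertex //; lia. Qed.
Lemma val_q : q = 1%N :> nat. Proof. by rewrite val_vertex //; lia. Qed.
Lemma val_v0 : v0 = 0%N :> nat. Proof. by rewrite val_vertex //; lia. Qed.

Lemma beta_gt0 x : (0 < beta x) = [&& x != p, x != q & x != v0].
Proof.
rewrite -!val_eqE /= val_p val_q val_v0 /beta i1; case: ifP; lia.
Qed.

Lemma rho_pq k : 0 < k < r ->
  (rho k p = p /\ rho k q = q \/ rho k p = q /\ rho k q = p) /\ rho k v0 = v0.
Proof.
move=> kr; have b0 x : (x = p \/ x = q \/ x = v0) -> beta x = 0%N.
  by move=> xE; apply/eqP; rewrite eqn0Ngt beta_gt0; case: xE => [|[]] ->;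
     rewrite eqxx ?andbF.
have [ek|nk] := eqVneq k 1%N.
  split; last first.
    apply: val_inj; rewrite /= val_rho ?ek ?val_v0; try lia.
    by rewrite /rho_map /alt_map i1 /=; case_ifs; lia.
  right; split; apply: val_inj; rewrite /= val_rho ?ek ?val_p ?val_q; try lia.
    by rewrite /rho_map /alt_map i1 /=; case_ifs; lia.
  by rewrite /rho_map /alt_map i1 /=; case_ifs; lia.
have lo x : (x = p \/ x = q \/ x = v0) -> rho k x = x.
  by move=> /b0 x0; apply: rho_low; rewrite ?x0; lia.
by split; [left; split; apply: lo; tauto | apply: lo; tauto].
Qed.

Lemma Gam_pq b g : g \in Gam 1 b ->
  (g p = p /\ g q = q \/ g p = q /\ g q = p) /\ g v0 = v0.
Proof.
move: g; apply: Gam_rect => [|g k [gpq gv] kb kr].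
  by rewrite !perm1; split=> //; left.
have [kpq kv] : (rho k p = p /\ rho k q = q \/ rho k p = q /\ rho k q = p) /\ rho k v0 = v0.
  by apply: rho_pq; lia.
rewrite !permM gv; split=> //.
by case: gpq => -[-> ->]; case: kpq => -[-> ->]; tauto.
Qed.

Section LinkedPoints.

Variable b : nat.
Hypothesis br : b < r.
Local Notation R := (linked (Gam 1 b) p q).

Lemma linked_beta_trans x y z : 0 < beta x -> 0 < beta y -> 0 < beta z -> R x y -> R y z -> R x z.
Proof.
rewrite !beta_gt0 => /and3P[? ? _] /and3P[? ? _] /and3P[? ? _].
exact: linked_trans.
Qed.

Lemma linked_rho k x y : 1 < k < b -> R x y -> R (rho k x) (rho k y).
Proof.
move=> kb; apply: linkedJ; first by apply: mem_rho; lia.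
left; have b0 z : z = p \/ z = q -> beta z = 0%N.
  by move=> zE; apply/eqP; rewrite eqn0Ngt beta_gt0; case: zE => ->; rewrite eqxx ?andbF.
by split; apply: rho_low; rewrite ?b0 //; try tauto; lia.
Qed.

(** [rho 1] itself links [tpt 1] to [tpt 2]; from there on [rho d] fixes [tpt 1] and moves [tpt d]
    to [tpt d.+1]. *)
Lemma linked_tpt d : 0 < d <= b -> R (tpt 1) (tpt d).
Proof.
elim: d => // d IH db; have [->|d0] := posnP d; first by left.
have [ed|nd] := eqVneq d 1%N.
  right; rewrite ed.
  suff <- : rho 1 = tperm (tpt 1) (tpt 2) * tperm p q by apply: mem_rho; lia.
  have t12 : rho 1 (tpt 1) = tpt 2.
    apply: val_inj; rewrite /= val_rho ?val_tpt; try lia.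
    by rewrite /rho_map /alt_map i1 /=; case_ifs; lia.
  have pq : rho 1 p = q.
    apply: val_inj; rewrite /= val_rho ?val_p ?val_q; try lia.
    by rewrite /rho_map /alt_map i1 /=; case_ifs; lia.
  have bpq x d' : 0 < d' <= r -> x = p \/ x = q -> x != tpt d'.
    move=> dr xE; apply/eqP=> xt; have := beta_gt0 x.
    by rewrite {1}xt beta_tpt; [case: xE => ->; rewrite eqxx ?andbF; lia | lia].
  apply/permP=> x; rewrite permM.
  case: (@tpermP _ (tpt 1) (tpt 2) x) => [->|->|xt xt'].
  - by rewrite t12 tpermD // bpq //; try tauto; lia.
  - by rewrite -t12 rhoK ?tpermD ?bpq //; try tauto; lia.
  case: (@tpermP _ p q x) => [->|->|xp xq] //.
    by rewrite -pq rhoK //; lia.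
  have xn := ltn_ord x; apply: val_inj; rewrite /= val_rho; last lia.
  have : [/\ x != tpt 1, x != tpt 2, x != p & x != q] by split; apply/eqP.
  rewrite -!val_eqE /= !val_tpt ?val_p ?val_q; try lia.
  case=> x1 x2 x3 x4; rewrite /rho_map /alt_map.
  by do ?[case: ifP => ?]; lia.
rewrite -(@rho_tpt d); last lia.
have -> : tpt 1 = rho d (tpt 1) by rewrite rho_low ?beta_tpt //; lia.
by apply: linked_rho; [lia | apply: IH; lia].
Qed.

(** Multiplying [rho 2], which is [(tpt 2 tpt 3)(spt 2 spt 3)], by the link [(tpt 2 tpt 3)(p q)]
    leaves [(spt 2 spt 3)(p q)]; the other links are transported by [rho d]. *)
Lemma linked_spt d : 1 < d <= b -> R (spt 2) (spt d).
Proof.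
elim: d => // d IH db; have [ed|d1] := eqVneq d 1%N; first by rewrite ed; left.
have [ed|nd] := eqVneq d 2%N; last first.
  rewrite -(@rho_spt d); last lia.
  have -> : spt 2 = rho d (spt 2) by rewrite rho_low ?beta_spt //; lia.
  by apply: linked_rho; [lia | apply: IH; lia].
have b1 d' : 0 < d' <= b -> 0 < beta (tpt d') by move=> ?; rewrite beta_tpt; lia.
have [t23|t23] : R (tpt 2) (tpt 3).
  apply: (linked_beta_trans (y := tpt 1)); try (by apply: b1; lia).
    by apply/linked_sym/linked_tpt; lia.
  by apply: linked_tpt; lia.
  by move: (congr1 beta t23); rewrite !beta_tpt; lia.
right; rewrite ed.
have -> : tperm (spt 2) (spt 3) * tperm p q = rho 2 * (tperm (tpt 2) (tpt 3) * tperm p q).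
  rewrite rho_tperm; try lia.
  have /commute_disjoint C : forall x, tperm (tpt 2) (tpt 3) x = x \/ tperm (spt 2) (spt 3) x = x.
    move=> x; case: (boolP (side x)) => sx; [left|right]; rewrite tpermD //;
      apply: neq_side; rewrite ?side_tpt ?side_spt ?sx ?(negPf sx) //; lia.
  by rewrite C mulgA -[_ * _ * tperm (tpt 2) _]mulgA tperm2 mulg1.
by apply: groupM => //; apply: mem_rho; lia.
Qed.

(** The passage from t-points to s-points is made by [rho (r - 3)] in block [r - 1], which is among
    the blocks [1], ..., [b] only for [b = r - 1]. *)
Lemma linked_cross : b = r.-1 -> R (tpt 1) (spt r.-1).
Proof.
move=> eb; have -> : spt r.-1 = rho (r - 3) (tpt r.-1).
  apply: beta_side_inj; rewrite ?beta_rho ?side_rho ?beta_spt ?beta_tpt ?side_spt ?side_tpt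
    /swap_map; try lia; case_ifs; lia.
have -> : tpt 1 = rho (r - 3) (tpt 1) by rewrite rho_low ?beta_tpt //; lia.
by apply: linked_rho; [lia | apply: linked_tpt; lia].
Qed.

Lemma linked_same_side x y : side x = side y -> 0 < beta x <= b -> 0 < beta y <= b -> R x y.
Proof.
move=> sxy xb yb; have [x0 y0] : 0 < beta x /\ 0 < beta y by lia.
case: (boolP (side x)) => sx.
  have sy : side y by rewrite -sxy.
  have [x1 y1] : 1 < beta x <= b /\ 1 < beta y <= b.
    by have := side_beta sx x0; have := side_beta sy y0; lia.
  have bs2 : 0 < beta (spt 2) by rewrite beta_spt //; lia.
  apply: (linked_beta_trans (y := spt 2)) => //.
    by rewrite (sptE sx x0); apply/linked_sym/linked_spt.
  by rewrite (sptE sy y0); apply: linked_spt.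
have sy : ~~ side y by rewrite -sxy.
have bt1 : 0 < beta (tpt 1) by rewrite beta_tpt //; lia.
apply: (linked_beta_trans (y := tpt 1)) => //.
  by rewrite (tptE sx x0); apply/linked_sym/linked_tpt.
by rewrite (tptE sy y0); apply: linked_tpt.
Qed.

Lemma linked_all x : b = r.-1 -> 0 < beta x <= b -> R (tpt 1) x.
Proof.
move=> eb xb; have [t1 t1'] : beta (tpt 1) = 1%N /\ side (tpt 1) = false.
  by rewrite beta_tpt ?side_tpt //; lia.
case: (boolP (side x)) => sx; last first.
  by apply: linked_same_side; rewrite ?t1 ?t1' ?(negPf sx) //; lia.
have [sr sr'] : beta (spt r.-1) = r.-1 /\ side (spt r.-1) = true.
  by rewrite beta_spt ?side_spt //; lia.
apply: (linked_beta_trans (y := spt r.-1)); rewrite ?t1 ?sr //; try lia; first exact: linked_cross.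
by apply: linked_same_side; rewrite ?sr ?sr' //; lia.
Qed.

Lemma mem_Gam_linked g : g \in Gam 1 b.+1 ->
  (forall x, 0 < beta x -> R x (g x)) -> g \in Gam 1 b.
Proof.
move=> gG Rg; have [gpq gv] := Gam_pq gG.
apply: (@mem_linked _ _ p q).
- by rewrite -val_eqE /= val_p val_q.
- exact: Gam_sub_Alt.
- exact: Gam_even gG.
move=> x xp xq; have gne y : y = p \/ y = q -> g x != y.
  move=> yE; apply/eqP=> gx.
  have [z zE gz] : exists2 z, z = p \/ z = q & g z = y.
    case: gpq => -[gp gq]; case: yE => ->; first by exists p; tauto.
    - by exists q; tauto.
    - by exists q; tauto.
    by exists p; tauto.
  have xz : x = z by apply: (@perm_inj _ g); rewrite gx gz.
  by case: zE => zE; rewrite xz zE eqxx in xp xq.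
split; try by apply: gne; tauto.
have [->|xv] := eqVneq x v0; first by rewrite gv; left.
by apply: Rg; rewrite beta_gt0 xp xq xv.
Qed.

End LinkedPoints.

Lemma Gam_inter_i1 b g : 0 < b < r -> g \in Gam 1 b.+1 -> g \in Gam 0 b -> g \in Gam 1 b.
Proof.
move=> b0 gG gG'; have br : b < r by lia.
have S1 h : h \in Gam 1 b -> h \in Gam 1 b.+1 by apply: GamS.
have S0 h : h \in Gam 1 b -> h \in Gam 0 b by apply: GamS.
have bg0 (f : {perm 'I_n}) x : f \in Gam 1 b.+1 -> 0 < beta x -> 0 < beta (f x).
  move=> fG; have [fpq fv] := Gam_pq fG; rewrite !beta_gt0.
  have finj u v : f u = v -> (f x == v) = (x == u) by move=> <-; rewrite (inj_eq perm_inj).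
  case: fpq => -[fp fq]; rewrite (finj _ _ fp) (finj _ _ fq) (finj _ _ fv) //.
  by case/and3P=> -> -> ->.
(* For [b <= r - 2] sides are preserved in the blocks up to [b], so links between points of the same
   side suffice. *)
have [b2|b2] := leqP b (r - 2).
  have [h hG ghE] := Gam_high b2 gG'.
  rewrite -[g](mulgK h) groupM ?groupV //.
  have fG : g * h \in Gam 1 b.+1 by rewrite groupM // S1.
  have fG' : g * h \in Gam 0 b by rewrite groupM // S0.
  move: (g * h) fG fG' ghE => f fG fG' fE.
  apply: mem_Gam_linked => // x x0; have fx0 := bg0 f x fG x0.
  have [xb|xb] := ltnP b (beta x); first by rewrite fE //; left.
  have fxb : beta (f x) <= b.
    rewrite leqNgt; apply/negP=> fxb; move: (fxb).
    by rewrite (perm_inj (fE _ fxb)) ltnNge xb.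
  have sf : side (f x) = side x.
    have [b3|b3] := leqP b (r - 3).
      by apply: Gam_side fG'; rewrite b3.
    have eb : b = (r - 2)%N by lia.
    move: fG'; rewrite eb => /(@Gam_side_low _ _ x)/(_ _)/andP[]; first by rewrite -eb.
    by move=> _ /eqP.
  by apply: linked_same_side; rewrite ?sf ?fx0 ?x0.
(* Now all points of the blocks up to [b] are linked, and only block [r] has to be fixed first. *)
have eb : b = r.-1 by lia.
have [h hG ghE] : exists2 h, h \in Gam 1 b & forall x, beta x = r -> (g * h) x = x.
  have gtip x : beta x = r -> beta (g x) = r.
    by move=> xr; have := Gam_tip br gG' (x := x); lia.
  have trr : beta (tpt r) = r by rewrite beta_tpt.
  have sg x : beta x = r -> side (g x) = side x (+) side (g (tpt r)).
    move=> xr; have [gx gt] : beta (g x) = beta x /\ beta (g (tpt r)) = beta (tpt r).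
      by rewrite !gtip // trr.
    have := side_block gx gt; rewrite xr trr side_tpt // addbF => <- //; last lia.
    by rewrite [RHS]addbC addbK.
  case sgt : (side (g (tpt r))) sg => sg; last first.
    exists 1; first exact: group1.
    by move=> x xr; rewrite mulg1; apply: beta_side_inj; rewrite ?gtip ?sg ?addbF //; lia.
  (* A flip of block [r] is undone by [rho (r - 3)]. *)
  exists (rho (r - 3)); first by apply: mem_rho; lia.
  move=> x xr; rewrite permM; have gx := gtip x xr.
  apply: beta_side_inj; rewrite ?beta_rho ?gx ?swap_map_gt ?xr; try lia.
  rewrite side_rho ?sg ?gx //; last lia.
  have -> : (r.-1 <= r) = true by lia.
  by rewrite eqxx /= addbK.
rewrite -[g](mulgK h) groupM ?groupV //.
have fG : g * h \in Gam 1 b.+1 by rewrite groupM // S1.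
move: (g * h) fG ghE => f fG fE.
apply: mem_Gam_linked => // x x0; have fx0 := bg0 f x fG x0.
have [xb|xb] := eqVneq (beta x) r; first by rewrite fE //; left.
have fxb : beta (f x) != r.
  by apply/eqP=> fxb; move/eqP: (fxb); rewrite (perm_inj (fE _ fxb)) (negPf xb).
have [xr fxr] := (beta_le x, beta_le (f x)).
apply: (linked_beta_trans (y := tpt 1)) => //; first by rewrite beta_tpt //; lia.
  by apply/linked_sym/linked_all; rewrite ?x0 //; lia.
by apply: linked_all; rewrite ?fx0 //; lia.
Qed.

End Degenerate.

(** * The alternating group *)

(* Position of the [q]-th point of a path of length [a] along the cycle of the product
   of its two alternating involutions, counted from the end of the path: the cycle
   visits 0, 1, 3, 5, ..., 4, 2. *)
Definition path_pos (a q : nat) : nat :=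
  if q == 0%N then 0%N else if q.*2 <= a then q.*2.-1 else (a - q).*2.

Lemma path_pos_lt a q : q < a -> path_pos a q < a.
Proof. by move=> qa; rewrite /path_pos; case_ifs; lia. Qed.

Lemma path_pos_inj a q q' : q < a -> q' < a -> path_pos a q = path_pos a q' -> q = q'.
Proof. by move=> qa qa'; rewrite /path_pos; case_ifs; lia. Qed.

Lemma path_pos_onto a p : p < a -> exists2 q, q < a & path_pos a q = p.
Proof.
move=> pa; case: (boolP (odd p)) => op.
  by exists p.+1./2; rewrite ?/path_pos; case_ifs; lia.
have [->|p0] := posnP p; first by exists 0%N => //; lia.
by exists (a - p./2)%N; rewrite ?/path_pos; case_ifs; lia.
Qed.

Lemma alt_map_rot o a q : q < a ->
  alt_map true o a (alt_map false o a (o + a - (path_pos a q).+1)) =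
  (o + a - (path_pos a (q.+1 %% a)).+1)%N.
Proof.
move=> qa; have -> : (q.+1 %% a)%N = if q.+1 == a then 0%N else q.+1.
  by case: eqP => [->|qa1]; rewrite ?modnn // modn_small //; lia.
by rewrite /alt_map /path_pos; case_ifs; lia.
Qed.

Definition is_path (o a : nat) := (o == 0) && (a == i + 4) || (o == N) && (a == i).

(** Indexed modulo [a], with 0 at the last vertex of the path, so that [rho 0 * rho 1] acts as the
    addition of 1. *)
Definition path_vertex (o a q : nat) : 'I_n := vertex (o + a - (path_pos a (q %% a)).+1).

Lemma is_path_gt0 o a : is_path o a -> 0 < a. Proof. by rewrite /is_path; lia. Qed.

Lemma val_path_vertex o a q : is_path o a ->
  path_vertex o a q = (o + a - (path_pos a (q %% a)).+1)%N :> nat.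
Proof.
move=> oa; have a0 := is_path_gt0 oa; rewrite val_vertex //.
by move: oa (path_pos_lt (ltn_pmod q a0)); rewrite /is_path; lia.
Qed.

Lemma path_vertex_eq o a q q' : is_path o a ->
  (path_vertex o a q == path_vertex o a q') = (q == q' %[mod a]).
Proof.
move=> oa; have a0 := is_path_gt0 oa; apply/eqP/eqP => [|e]; last by rewrite /path_vertex e.
move/(congr1 val); rewrite /= !val_path_vertex // => e.
apply: (path_pos_inj (ltn_pmod q a0) (ltn_pmod q' a0)).
by have := path_pos_lt (ltn_pmod q a0); have := path_pos_lt (ltn_pmod q' a0); lia.
Qed.

Lemma path_vertex_onto o a (x : 'I_n) : is_path o a -> o <= x < o + a ->
  exists q, x = path_vertex o a q.
Proof.
move=> oa xo; have [|q qa qE] := @path_pos_onto a (o + a - x.+1); first lia.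
exists q; apply: val_inj; rewrite /= val_path_vertex // modn_small // qE; lia.
Qed.

Lemma rot_path_vertex o a q m : is_path o a ->
  ((rho 0 * rho 1) ^+ m) (path_vertex o a q) = path_vertex o a (q + m).
Proof.
move=> oa; elim: m => [|m IH]; first by rewrite expg0 perm1 addn0.
rewrite expgSr permM IH permM; apply: val_inj; rewrite /= !val_rho; try lia.
have a0 := is_path_gt0 oa; rewrite !val_path_vertex //.
have := alt_map_rot o (ltn_pmod (q + m) a0).
have -> : (((q + m) %% a).+1 %% a = (q + m.+1) %% a)%N.
  by rewrite -addn1 modnDml addn1 addnS.
move=> <-; have := path_pos_lt (ltn_pmod (q + m) a0); move: (path_pos _ _) => p pa.
set v := (o + a - p.+1)%N.
have [vo wo] : (v < N) = (o == 0%N) /\ (alt_map false o a v < N) = (o == 0%N).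
  by move: oa; rewrite /is_path /v /alt_map; split; case_ifs; lia.
rewrite {2}/rho_map /= vo /rho_map /=.
have N0 : (N == 0)%N = false by lia.
by case/orP: oa wo => /andP[/eqP-> /eqP->]; rewrite ?N0 /= => ->.
Qed.

Lemma rot_off_path m (x : 'I_n) : i + 4 <= x < N \/ N + i <= x ->
  ((rho 0 * rho 1) ^+ m) x = x.
Proof.
move=> xI; have f k : k < 2 -> rho k x = x.
  move=> k2; apply: val_inj; rewrite /= val_rho; last lia.
  by rewrite /rho_map /alt_map; case_ifs; lia.
by elim: m => [|m IH]; rewrite ?perm1 // expgSr !permM IH !f.
Qed.

Lemma is_pathT : is_path 0 (i + 4). Proof. by rewrite /is_path !eqxx. Qed.
Lemma is_pathS : is_path N i. Proof. by rewrite /is_path !eqxx orbT. Qed.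

(** Powers act on each path by translation, so both lengths divide the order; conversely the power
    [lcmn (i + 4) i] is trivial on both paths, and the other points are fixed. *)
Lemma order_rot : #[rho 0 * rho 1] = lcmn (i + 4) i.
Proof.
have dv o a : is_path o a -> a %| #[rho 0 * rho 1].
  move=> oa; have := rot_path_vertex 0 #[rho 0 * rho 1] oa.
  rewrite expg_order perm1 add0n => /esym/eqP.
  by rewrite path_vertex_eq // mod0n.
apply/eqP; rewrite eqn_dvd order_dvdn dvdn_lcm (dv _ _ is_pathT) (dv _ _ is_pathS).
rewrite !andbT; apply/eqP/permP=> x; rewrite perm1.
have fix_path o a : is_path o a -> a %| lcmn (i + 4) i -> o <= x < o + a ->
    ((rho 0 * rho 1) ^+ lcmn (i + 4) i) x = x.
  move=> oa adv xo; have [q ->] := path_vertex_onto oa xo.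
  rewrite rot_path_vertex //; apply/eqP; rewrite path_vertex_eq //.
  by rewrite -modnDmr (eqP adv) addn0.
have [x1|x1] := ltnP x (i + 4); first exact: fix_path is_pathT (dvdn_lcml _ _) _.
have [x2|x2] := ltnP x N; first by apply: rot_off_path; left; rewrite x1.
have [x3|x3] := ltnP x (N + i); last by apply: rot_off_path; right.
by apply: fix_path is_pathS (dvdn_lcmr _ _) _; rewrite x2.
Qed.

Section AlternatingGroup.

Local Notation G := (Gam 0 r).
(** Products act from left to right, so for distinct points this is the 3-cycle
    [a -> b -> y -> a]. *)
Local Notation cyc3 a b y := (tperm a b * tperm a y \in G).

Lemma cyc3J h a b y : h \in G -> cyc3 a b y -> cyc3 (h a) (h b) (h y).
Proof. by move=> hG aG; rewrite -!tpermJ -conjMg groupJ. Qed.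

Lemma cyc3V a b y : cyc3 a b y -> cyc3 a y b.
Proof. by rewrite -groupV invMg !tpermV. Qed.

Lemma cyc3_trans a b y z : cyc3 a b y -> cyc3 a b z -> cyc3 a y z.
Proof.
move=> /cyc3V ay az; have := groupM ay az.
by rewrite -mulgA [tperm a b * (_ * _)]mulgA tperm2 mul1g.
Qed.

Lemma cyc3_rot a b y : a != b -> b != y -> a != y -> cyc3 a b y -> cyc3 b y a.
Proof.
move=> ab by_ ay h; have := cyc3J h h.
have -> : (tperm a b * tperm a y) a = b by rewrite permM tpermL tpermD // eq_sym.
have -> : (tperm a b * tperm a y) b = y by rewrite permM tpermR tpermL.
by have -> : (tperm a b * tperm a y) y = a by rewrite permM (tpermD (z := y)) ?tpermR.
Qed.

Lemma tpt2_path : tpt 2 = path_vertex 0 (i + 4) 0.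
Proof.
apply: val_inj; rewrite /= val_path_vertex ?is_pathT // val_tpt; last lia.
by rewrite mod0n /path_pos /=; lia.
Qed.

Lemma spt2_path : spt 2 = path_vertex N i 0.
Proof.
apply: val_inj; rewrite /= val_path_vertex ?is_pathS // val_spt; last lia.
by rewrite mod0n /path_pos /=; lia.
Qed.

(* [(rho 0 * rho 1) ^+ i] rotates the t-path nontrivially but is trivial on the s-path,
   so that its commutator with [rho 2] is a 3-cycle. *)
Lemma cyc3_start : exists2 x, beta x < 2 & cyc3 x (tpt 2) (tpt 3).
Proof.
pose t := (rho 0 * rho 1) ^+ i.
have m G' : G' < r -> rho G' \in G by move=> ?; apply: mem_rho.
have tG : t \in G by apply: groupX; apply: groupM; apply: m; lia.
pose x := path_vertex 0 (i + 4) i.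
have t2 : t (tpt 2) = x by rewrite tpt2_path rot_path_vertex ?is_pathT.
have t3 : t (tpt 3) = tpt 3.
  by apply: rot_off_path; left; rewrite val_tpt //; lia.
have s2 : t (spt 2) = spt 2.
  rewrite spt2_path rot_path_vertex ?is_pathS //; apply/eqP.
  by rewrite path_vertex_eq ?is_pathS // add0n modnn mod0n.
have s3 : t (spt 3) = spt 3.
  by apply: rot_off_path; right; rewrite val_spt //; lia.
have xt2 : x != tpt 2.
  by rewrite tpt2_path path_vertex_eq ?is_pathT // modn_small ?mod0n; lia.
have bx : beta x < 2.
  move: xt2; rewrite -val_eqE /= val_tpt; last lia.
  rewrite /beta val_path_vertex ?is_pathT //.
  have := path_pos_lt (ltn_pmod i (is_path_gt0 is_pathT)).
  by move: (path_pos _ _) => p; case: ifP; lia.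
exists x => //; have r2E := @rho_tperm 2.
have h : tperm (tpt 3) x * tperm (tpt 3) (tpt 2) \in G.
  have -> : tperm (tpt 3) x * tperm (tpt 3) (tpt 2) = rho 2 ^ t * rho 2.
    rewrite r2E; try lia; rewrite conjMg !tpermJ t2 t3 s2 s3.
    have /commute_disjoint C :
        forall y, tperm (tpt 2) (tpt 3) y = y \/ tperm (spt 2) (spt 3) y = y.
      move=> y; case: (boolP (side y)) => sy; [left|right]; rewrite tpermD //;
        apply: neq_side; rewrite ?side_tpt ?side_spt ?sy ?(negPf sy) //; lia.
    rewrite C -mulgA [tperm (spt 2) _ * (_ * _)]mulgA tperm2 mul1g.
    by rewrite tpermC [tperm (tpt 2) _]tpermC.
  by apply: groupM; rewrite ?groupJ ?m //; lia.
apply: cyc3_rot h.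
- by apply: neq_beta; rewrite beta_tpt; lia.
- by [].
by apply: neq_beta; rewrite !beta_tpt; lia.
Qed.

(** For [k > 2] the generator [rho k] fixes [x] and [tpt 2]; the third point is moved along the
    t-points up to block [r], over a crossing edge, and back down the s-points. *)
Lemma cyc3_high x y : beta x < 2 -> cyc3 x (tpt 2) (tpt 3) -> 2 < beta y -> cyc3 x (tpt 2) y.
Proof.
move=> bx h3.
have step k y' : 2 < k < r -> cyc3 x (tpt 2) y' -> cyc3 x (tpt 2) (rho k y').
  move=> kr; have kG : rho k \in G by apply: mem_rho; lia.
  move/(cyc3J kG); rewrite rho_low; try lia.
  by rewrite [rho k (tpt 2)]rho_low ?beta_tpt //; lia.
have ht d : 2 < d <= r -> cyc3 x (tpt 2) (tpt d).
  elim: d => // d IH dr; have [->//|d2] := eqVneq d 2%N.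
  rewrite -(@rho_tpt d); last lia.
  by apply: step; [lia | apply: IH; lia].
have flip d : r.-1 <= d <= r -> rho (r - 3) (tpt d) = spt d.
  move=> dr; apply: val_inj; rewrite /= val_rho ?val_tpt ?val_spt; try lia.
  by rewrite /rho_map; case_ifs; lia.
have hs m : m <= r - 3 -> cyc3 x (tpt 2) (spt (r - m)).
  elim: m => [|m IH] mr.
    by rewrite subn0 -flip; [apply: step; [lia | apply: ht; lia] | lia].
  have -> : spt (r - m.+1) = rho (r - m.+1) (spt (r - m)).
    have -> : (r - m = (r - m.+1).+1)%N by lia.
    by rewrite -rho_spt ?rhoK //; lia.
  by apply: step; [lia | apply: IH; lia].
move=> y2; have yr := beta_le y; have y0 : 0 < beta y by lia.
case: (boolP (side y)) => sy.
  rewrite (sptE sy y0); have -> : beta y = (r - (r - beta y))%N by lia.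
  by apply: hs; lia.
by rewrite (tptE sy y0); apply: ht; lia.
Qed.

(* The 3-cycles are first spread over the points of index > 2 by [rho 3], ..., and then,
   with two base points fixed by [rho 0], [rho 1] and [rho 2], over both paths. *)
Lemma Alt_sub_Gam : 'Alt_('I_n) \subset G.
Proof.
have [x bx h3] := cyc3_start.
have bt d : d <= 5 -> beta (tpt d) = d by move=> d5; apply: beta_tpt; lia.
have hx y : 2 < beta y -> cyc3 x (tpt 2) y by apply: cyc3_high.
have ne y z : beta y != beta z -> y != z by apply: neq_beta.
have h4 y : y != tpt 4 -> 2 < beta y -> cyc3 (tpt 4) x y.
  move=> y4 y2; apply: cyc3V; apply: cyc3_rot (cyc3_trans (hx (tpt 4) _) (hx y y2)).
  - by apply: ne; rewrite bt; lia.
  - by rewrite eq_sym.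
  - by apply: ne; lia.
  by rewrite bt.
have h42 : cyc3 (tpt 4) x (tpt 2).
  apply: (@cyc3_rot (tpt 2)); try by apply: ne; rewrite ?bt; lia.
  apply: (@cyc3_rot x); try by apply: ne; rewrite ?bt; lia.
  by apply: hx; rewrite bt.
have h45 : cyc3 (tpt 4) x (tpt 5) by apply: h4; rewrite ?bt //; apply: ne; rewrite !bt.
have hlow k y : k < 3 -> cyc3 (tpt 4) (tpt 5) y -> cyc3 (tpt 4) (tpt 5) (rho k y).
  move=> k3; have kG : rho k \in G by apply: mem_rho; lia.
  have kr3 : (k == r - 3)%N && false = false by rewrite andbF.
  move/(cyc3J kG); rewrite !(@rho_high k (tpt _)) ?bt //; lia.
have hrot m y : cyc3 (tpt 4) (tpt 5) y ->
    cyc3 (tpt 4) (tpt 5) (((rho 0 * rho 1) ^+ m) y).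
  move=> hy; elim: m => [|m IH]; first by rewrite perm1.
  by rewrite expgSr !permM; apply: (hlow 1%N) => //; apply: (hlow 0%N).
have h52 : cyc3 (tpt 4) (tpt 5) (tpt 2) by apply: cyc3_trans h45 h42.
(* [spt 2] ends the s-path; it is reached through [rho 2] from [spt 3], which [h4] covers. *)
have h5s : cyc3 (tpt 4) (tpt 5) (spt 2).
  have -> : spt 2 = rho 2 (spt 3) by rewrite -(@rho_spt 2) ?rhoK //; lia.
  apply: hlow => //; apply: cyc3_trans h45 _; apply: h4.
    by apply: ne; rewrite beta_spt ?bt; lia.
  by rewrite beta_spt; lia.
apply: (@Alt_of_3cycles _ _ (tpt 4) (tpt 5)); first by apply: ne; rewrite !bt.
  exact: Gam_sub_Alt.
move=> y y4 y5; have [y2|y2] := ltnP 2 (beta y).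
  exact: cyc3_trans h45 (h4 y y4 y2).
have hp o a : is_path o a -> cyc3 (tpt 4) (tpt 5) (path_vertex o a 0) ->
    o <= y < o + a -> cyc3 (tpt 4) (tpt 5) y.
  move=> oa h0 yo; have [q ->] := path_vertex_onto oa yo.
  by rewrite -[q]add0n -rot_path_vertex //; apply: hrot.
move: y2; rewrite /beta; case: ifP => yN y2.
  by apply: hp is_pathT _ _; [rewrite -tpt2_path | lia].
by apply: hp is_pathS _ _; [rewrite -spt2_path | have := ltn_ord y; lia].
Qed.

End AlternatingGroup.

(** * Schläfli type *)

Lemma order3 (x : {perm 'I_n}) : x != 1 -> x ^+ 3 = 1 -> #[x] = 3.
Proof. by move=> x1 x3; apply: nt_prime_order. Qed.

Lemma order6 (x : {perm 'I_n}) : x ^+ 6 = 1 -> x ^+ 2 != 1 -> x ^+ 3 != 1 -> #[x] = 6.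
Proof.
move=> /eqP; rewrite -order_dvdn => d6; rewrite -!order_dvdn.
have := dvdn_leq (isT : 0 < 6) d6; move: d6.
by move: #[x]; do 7?[case=> //].
Qed.

Lemma rot_tpt k : 0 < k -> k.+1 < r -> 2 < i + k -> (rho k * rho k.+1) (tpt k) != tpt k.
Proof.
move=> k0 kr ik; apply: neq_beta.
by rewrite permM beta_rot // beta_tpt ?/rot3; case_ifs; lia.
Qed.

(** Without the label [r - 3] no side changes, and the cube preserves every block. *)
Lemma order_rho3 k : 1 < k -> k.+1 < r -> k != (r - 3)%N -> k != (r - 4)%N ->
  #[rho k * rho k.+1] = 3.
Proof.
move=> k1 kr k3 k4; apply: order3.
  by apply: contraTneq (rot_tpt (ltnW k1) kr _) => [->|]; rewrite ?perm1 ?eqxx //; lia.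
apply/permP=> x; rewrite perm1 -/(cube_rho k).
have [xk|xk] := ltnP (beta x) k; first by rewrite cube_rho_low.
have nf j y : j = k \/ j = k.+1 -> side (rho j y) = side y.
  move=> jk; rewrite side_rho; last lia.
  have -> : (j == r - 3)%N = false by lia.
  by rewrite addbF.
apply: beta_side_inj; rewrite ?beta_cube_rho ?cube_rhoE ?nf //; try tauto; lia.
Qed.

(** The square still rotates three blocks, whereas the cube is a nontrivial flip. *)
Lemma order_rho6 k : r - 4 <= k <= r - 3 -> #[rho k * rho k.+1] = 6.
Proof.
move=> kr; have [k1 kr'] : 1 < k /\ k.+1 < r by lia.
have bcube x : beta (cube_rho k x) = beta x by apply: beta_cube_rho; lia.
apply: order6.
- rewrite (expgM _ 3 2) -/(cube_rho k); apply/permP=> x; rewrite perm1 permM.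
  have [xk|xk] := ltnP (beta x) k; first by rewrite !cube_rho_low ?bcube.
  apply: beta_side_inj; rewrite ?bcube //; first lia.
  by rewrite !side_cube_rho // bcube addbK.
- apply: contraTneq (isT) => /permP/(_ (tpt k))/(congr1 beta).
  rewrite perm1 permM !permM !beta_rot ?beta_tpt /rot3; try lia.
  by case_ifs; lia.
apply: contraTneq (isT) => /permP/(_ (tpt r))/(congr1 side).
rewrite perm1 -/(cube_rho k) side_cube_rho // side_tpt // beta_tpt //.
by case: ifP; lia.
Qed.

(** The product is a 3-cycle on the t-points of the blocks 1 to 3 and acts as the involution [rho 1]
    outside the blocks. The s-points are computed separately for [i = 1], when block 1 has none. *)
Lemma order_rho12 : #[rho 1 * rho 2] = 6.
Proof.
have act k x y : k < r -> rho_map k x = y ->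
    forall u v : 'I_n, u = x :> nat -> v = y :> nat -> rho k u = v.
  by move=> kr xy u v ux vy; apply: val_inj; rewrite /= val_rho // ux vy.
have vt d : d <= 3 -> tpt d = (i + 1 + d)%N :> nat by move=> ?; rewrite val_tpt //; lia.
have vs d : d <= 3 -> spt d = (N + i + d - 3)%N :> nat by move=> ?; rewrite val_spt //; lia.
have t11 : rho 1 (tpt 1) = tpt 2.
  by apply: act (erefl _) _ _ _ _; rewrite ?vt // /rho_map /alt_map; case_ifs; lia.
have t12 : rho 1 (tpt 2) = tpt 1 by rewrite -t11 rhoK //; lia.
have t13 : rho 1 (tpt 3) = tpt 3.
  by apply: act (erefl _) _ _ _ _; rewrite ?vt // /rho_map /alt_map; case_ifs; lia.
have t21 : rho 2 (tpt 1) = tpt 1 by apply: rho_low; rewrite ?beta_tpt //; lia.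
have t22 : rho 2 (tpt 2) = tpt 3 by apply: rho_tpt; lia.
have t23 : rho 2 (tpt 3) = tpt 2 by rewrite -t22 rhoK //; lia.
have tE := (t11, t12, t13, t21, t22, t23).
have rho1_0 x : beta x = 0%N -> beta (rho 1 x) = 0%N.
  rewrite /beta val_rho; last lia.
  by have := ltn_ord x; rewrite /rho_map /alt_map /=; case_ifs; lia.
have rho2_0 x : beta x = 0%N -> rho 2 x = x by move=> x0; apply: rho_low; lia.
have step0 x : beta x = 0%N -> (rho 1 * rho 2) x = rho 1 x.
  by move=> x0; rewrite permM rho2_0 ?rho1_0.
have rho1K x : rho 1 (rho 1 x) = x by apply: rhoK; lia.
have step2 x : beta x = 0%N -> (rho 1 * rho 2) ((rho 1 * rho 2) x) = x.
  by move=> x0; rewrite (step0 x) // step0 ?rho1K ?rho1_0.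
have high k x : 0 < k <= 2 -> 3 < beta x -> rho k x = x.
  by move=> k2 x3; apply: rho_high; lia.
have exp6 (p : {perm 'I_n}) x : (p ^+ 6) x = p (p (p (p (p (p x))))).
  by rewrite !expgS expg0 mulg1 !permM.
apply: order6.
- apply/permP=> x; rewrite perm1 exp6.
  have [x0|x0] := posnP (beta x).
    by rewrite !step2.
  have [x3|x3] := ltnP 3 (beta x).
    have px : (rho 1 * rho 2) x = x by rewrite permM (high 1%N) ?(high 2).
    by rewrite !px.
  have cases (f : nat -> 'I_n) : x = f (beta x) -> [\/ x = f 1%N, x = f 2%N | x = f 3%N].
    move=> xE; have : [\/ beta x = 1, beta x = 2 | beta x = 3]%N.
      by case: (beta x) x0 x3 => [|[|[|[|m]]]] //; [constructor 1 | constructor 2 | constructor 3].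
    by case=> e; rewrite e in xE; [constructor 1 | constructor 2 | constructor 3].
  case: (boolP (side x)) => sx; last first.
    by have [] := cases _ (tptE sx x0) => ->; rewrite !permM !tE.
  have s22 : rho 2 (spt 2) = spt 3 by apply: rho_spt; lia.
  have s23 : rho 2 (spt 3) = spt 2 by rewrite -s22 rhoK //; lia.
  have s13 : rho 1 (spt 3) = spt 3.
    by apply: act (erefl _) _ _ _ _; rewrite ?vs // /rho_map /alt_map; case_ifs; lia.
  have [i1|i1] := eqVneq i 1%N.
    have s12 : rho 1 (spt 2) = spt 2.
      by apply: act (erefl _) _ _ _ _; rewrite ?vs // /rho_map /alt_map; case_ifs; lia.
    have sE := (s12, s13, s22, s23).
    have [] := cases _ (sptE sx x0) => xE; last 2 first.
    - by rewrite xE !permM !sE.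
    - by rewrite xE !permM !sE.
    by move: sx; rewrite xE /side vs //; lia.
  have s11 : rho 1 (spt 1) = spt 2.
    by apply: act (erefl _) _ _ _ _; rewrite ?vs // /rho_map /alt_map; case_ifs; lia.
  have s12 : rho 1 (spt 2) = spt 1 by rewrite -s11 rho1K.
  have s21 : rho 2 (spt 1) = spt 1 by apply: rho_low; rewrite ?beta_spt //; lia.
  have sE := (s11, s12, s13, s21, s22, s23).
  by have [] := cases _ (sptE sx x0) => ->; rewrite !permM !sE.
- apply: contraTneq (isT) => /permP/(_ (tpt 1))/(congr1 beta).
  by rewrite perm1 expgS expg1 !permM !tE !beta_tpt //; lia.
(* [vertex i] is [t_(i+1)], a point outside the blocks that [rho 1] moves. *)
apply: contraTneq (isT) => /permP/(_ (vertex i)).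
have vw : vertex i = i :> nat by rewrite val_vertex //; lia.
have w0 : beta (vertex i) = 0%N by rewrite /beta vw; case: ifP; lia.
have exp3 (p : {perm 'I_n}) x : (p ^+ 3) x = p (p (p x)).
  by rewrite !expgS expg0 mulg1 !permM.
rewrite perm1 exp3 (step2 (vertex i)) // step0 // => /(congr1 val) /=; rewrite val_rho; last lia.
by rewrite vw /rho_map /alt_map; case_ifs; lia.
Qed.

(** * Defining relations, intersection property and final identifications *)

Lemma rho_neq1 k : k < r -> rho k != 1.
Proof.
move=> kr; have [k1|k1] := ltnP 1 k.
  apply: contraTneq (isT) => /permP/(_ (tpt k))/(congr1 beta).
  by rewrite perm1 rho_tpt ?beta_tpt //; lia.
apply: contraTneq (isT) => /permP/(_ (tpt 1))/(congr1 val).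
rewrite perm1 /= val_rho // val_tpt; last lia.
by rewrite /rho_map /alt_map; case_ifs; lia.
Qed.

Lemma sggi_rho : is_sggi r rho.
Proof.
split=> [k kr|j k jr kr jk].
  by apply: nt_prime_order => //; rewrite ?rho_neq1 // expgS expg1 rho2.
have C : commute (rho j) (rho k).
  by case: jk => jk; [|apply: commute_sym]; apply: commute_rho.
by rewrite expgMn // !expgS expg0 !mulg1 !rho2 // mulg1.
Qed.

Lemma intersection_rho : intersection_property r rho.
Proof.
apply: intersection_property_string => [j k jr kr jk|a b abr]; first exact: commute_rho.
apply/subsetP=> g /setIP[gG' gG].
(* The smallest common label is [a.+1]; only [i = 1] with [a = 0] escapes the block argument. *)
have [ia|ia] := ltnP 2 (i + a.+1).
  by apply: Gam_inter_blocks; rewrite //; lia.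
have [i1 a0] : i = 1%N /\ a = 0%N by lia.
by subst a; apply: Gam_inter_i1; rewrite // (andP abr).2 (leq_ltn_trans _ (andP abr).1).
Qed.

Lemma sggi_group_rho : sggi_group r rho = 'Alt_('I_n).
Proof.
have -> : sggi_group r rho = Gam 0 r.
  by rewrite /sggi_group /=; congr (<<gens _ _>>); apply/setP=> k; rewrite !inE ltn_ord.
by apply/eqP; rewrite eqEsubset Gam_sub_Alt Alt_sub_Gam.
Qed.

Lemma schlafli_rho :
  schlafli r rho = [:: lcmn (i + 4) i, 6 & nseq (r - 6) 3 ++ [:: 6; 6; 3]].
Proof.
have -> : schlafli r rho = [seq #[rho j * rho j.+1] | j <-
    [:: 0; 1] ++ iota 2 (r - 6) ++ [:: r - 4; r - 3; r - 2]]%N.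
  rewrite /schlafli; congr map; have -> : r.-1 = (2 + ((r - 6) + 3))%N by lia.
  rewrite !iotaD /=; congr [:: _, _ & _ ++ _].
  by congr [:: _; _; _]; lia.
rewrite !map_cat /= order_rot order_rho12; congr [:: _, _ & _ ++ _]; last first.
  by rewrite (@order_rho6 (r - 4)) ?(@order_rho6 (r - 3)) ?(@order_rho3 (r - 2)) //; lia.
rewrite -[in RHS](size_iota 2 (r - 6)) -[in RHS](size_map (fun j => #[rho j * rho j.+1])).
apply/all_pred1P/allP=> m /mapP[j]; rewrite mem_iota => jI -> /=.
by rewrite order_rho3 //; lia.
Qed.

End Graph.

Local Close Scope group_scope.

Theorem theorem4p1 (n r : nat) :
  ~~ odd n -> 14 <= n -> 6 <= r -> r <= (n - 2)./2 ->
  let i := (n./2 - r)%N in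
  let rho := thm41_rho n r in
  (sggi_group r rho \isog 'Alt_('I_n))%g /\
  string_C_group r rho /\
  schlafli r rho = [:: lcmn (i + 4) i, 6 & nseq (r - 6) 3 ++ [:: 6; 6; 3]].
Proof.
move=> en n14 r6 rn i rho.
have nE : n = (i + r).*2 by rewrite /i; lia.
have i0 : 0 < i by rewrite /i; lia.
split; first by rewrite /rho /thm41_rho sggi_group_rho // isog_refl.
split; first by split; [exact: sggi_rho | exact: intersection_rho].
exact: schlafli_rho.
Qed.
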